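(* Let $\alpha>0$ and let $(X_n)_{n\geq 0}$, $(Y_n)_{n\geq 0}$, $(Z_n)_{n\geq 0}$ be independent simple random walks on the graph $\mathrm{Comb}_{\ell}(\mathbb{Z},\alpha)$, all started at $\mathbf{0}=(0,0)$; write $\mathbb{P}^{\mathbf{0},\mathbf{0},\mathbf{0}}$ for their joint law. Then: (a) if $\alpha>1$, then $\mathbb{P}^{\mathbf{0},\mathbf{0},\mathbf{0}}\left(|\{n\in\mathbb{N}_0: X_n=Y_n=Z_n\}|<\infty\right)=1$; (b) if $\alpha\leq 1$, then $\mathbb{P}^{\mathbf{0},\mathbf{0},\mathbf{0}}\left(|\{n\in\mathbb{N}_0: X_n=Y_n=Z_n\}|=\infty\right)=1$.
   Context: $\mathbb{N}_0=\{0,1,2,\dots\}$, and $\log^{\alpha}(t)$ means $(\log t)^{\alpha}$. The graph $\mathrm{Comb}_{\ell}(\mathbb{Z},\alpha)$ has vertex set $\{(n,x)\in\mathbb{Z}^2: 0\leq x\leq 0\vee\log^{\alpha}(|n|)\}$, where the upper bound is read as $0$ when $n=0$. Its edges are the horizontal edges between $(n,0)$ and $(n+1,0)$ for all $n\in\mathbb{Z}$, and the vertical edges between $(n,x)$ and $(n,x+1)$ whenever both are vertices. A simple random walk on this graph is the discrete-time Markov chain which at each step moves to a uniformly chosen neighbour of its current vertex. *)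

(* Defs.v *)
From HB Require Import structures.
From mathcomp Require Import all_boot all_order all_algebra finmap.
From mathcomp Require Import all_classical all_reals all_analysis.

Set Implicit Arguments.
Unset Strict Implicit.
Unset Printing Implicit Defensive.
Import Order.TTheory GRing.Theory Num.Theory.

Local Open Scope classical_set_scope.
Local Open Scope ring_scope.

Section Comb.
Context {R : realType}.

Definition comb_height (alpha : R) (n : int) : R :=
  if n == 0 then 0 else Num.max 0 (ln (`|n|%:~R) `^ alpha).

Definition comb_vertex (alpha : R) : set (int * int) :=
  [set v | 0 <= v.2 /\ v.2%:~R <= comb_height alpha v.1].

Definition comb_edge (u v : int * int) : Prop :=
  (exists n : int, u = (n, 0) /\ v = (n + 1, 0)) \/
  (exists n x : int, u = (n, x) /\ v = (n, x + 1)).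

Definition comb_adj (alpha : R) (u v : int * int) : Prop :=
  [/\ comb_vertex alpha u, comb_vertex alpha v & comb_edge u v \/ comb_edge v u].

End Comb.

Section RandomWalk.
Context {R : realType} {V : choiceType}.

(* [fset_set] of an infinite set is empty, so [degree] is meaningful only for
   locally finite graphs. *)
Definition degree (adj : V -> V -> Prop) (u : V) : nat :=
  #|` fset_set [set v | adj u v] |.

Definition srw_step (adj : V -> V -> Prop) (u v : V) : R :=
  if `[< adj u v >] then (degree adj u)%:R^-1 else 0.

Context {d : measure_display} {T : measurableType d}.

(* The state space carries the discrete sigma-algebra. The Markov property is
   multiplied out, so that histories of probability zero need no convention. *)
Definition simple_random_walk (P : probability T R) (adj : V -> V -> Prop)
    (o : V) (X : nat -> T -> V) : Prop :=
  [/\ forall n (A : set V), measurable (X n @^-1` A),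
      P [set w | X 0%N w = o] = 1%E &
      forall (n : nat) (x : nat -> V),
        P [set w | forall k, (k <= n.+1)%N -> X k w = x k] =
        (P [set w | forall k, (k <= n)%N -> X k w = x k]
           * (srw_step adj (x n) (x n.+1))%:E)%E].

Definition process_sigma (X : nat -> T -> V) : set (set T) :=
  <<s [set B | exists n (A : set V), B = X n @^-1` A] >>.

(* The product rule for pairs is the case where one of the events is [setT]. *)
Definition independent3 (P : probability T R) (X Y Z : nat -> T -> V) : Prop :=
  forall A B C, process_sigma X A -> process_sigma Y B -> process_sigma Z C ->
    P (A `&` B `&` C) = (P A * P B * P C)%E.

End RandomWalk.

(* Main.v *)
Require Import Defs.
From mathcomp Require Import all_boot all_order all_algebra.
From mathcomp Require Import ring lra zify.
From mathcomp Require Import all_classical all_reals all_analysis.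
Import Order.TTheory GRing.Theory Num.Theory.
Set Implicit Arguments.
Unset Strict Implicit.
Unset Printing Implicit Defensive.
Local Open Scope classical_set_scope.
Local Open Scope ring_scope.

(** Whether three walks meet infinitely often is decided by the growth of the
    comb.  Write [h] for the height profile of the teeth and [a r] for
    [h r + 1], the number of vertices of a tooth at distance [r] from the origin.
    A walk needs time of order [r * (r * a r)], resistance times volume, to spread
    over the [r * a r] vertices at horizontal distance at most [r], and it is then
    roughly uniform there.  Hence at such a time it sits at a given vertex with
    probability of order [1 / (r * a r)], and three independent walks agree with
    probability of order [1 / (r * a r) ^ 2].  There are about [4 ^ j * a (2 ^ j)]
    times belonging to radii between [2 ^ j] and [2 ^ (j + 1)], so level [j]
    contributes about [1 / a (2 ^ j)] to the expected number of meetings.  For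
    logarithmic teeth [a (2 ^ j)] is of order [j ^ alpha], and the sum over the
    levels is finite exactly when [alpha > 1].

    The upper bound on the heat kernel is an energy argument.  On a finite
    reversible graph the Dirichlet energy of the kernel decreases in time and
    telescopes along the return probabilities ([energy_heat2_le]), while energy
    controls oscillation along paths ([energy_path]).  If the kernel were large at
    its starting point it would be large on a whole ball, contradicting total mass
    one ([diag_le]).  The comb is compared with its finite boxes, which a walk
    cannot distinguish from the comb before reaching the boundary
    ([iter_transition_box]).

    The lower bound needs that the walk is still near its start at the time scale of
    level [j].  This follows from an explicit function whose expectation along
    the walk drops by at most one per step ([transition_barrier], [confine]).  The
    energy bound also says that the kernel forgets its starting point, which gives
    a lower bound on meetings from any three starting points of equal parity
    ([collision_lower]).

    If [alpha > 1], the Borel-Cantelli lemma concludes.  If [alpha <= 1], splitting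
    at the first meeting bounds the expected number of meetings up to time [n] by
    the probability of a meeting times the largest such expectation from a common
    starting point ([green_miss]).  Both expectations are of the order of the partial
    sum of [1 / a (2 ^ j)], so from every starting point a meeting occurs before some
    time with probability bounded below, uniformly ([miss_uniform]).  The walk is
    confined to a finite set at each time, so the argument can be restarted, and the
    probability of no further meeting is at most any power of a number below one
    ([miss_geometric]).  The Markov chain computations enter the probability
    space through [pr_obey], which bounds the probability that the three walks
    satisfy prescribed constraints at successive times by an iterated
    transition operator. *)

(** * Sums over sequences without repetition *)

(** Sums over boxes and sums over neighbours are compared through the support
    of the summand. *)
Lemma eq_big_support (R : nmodType) (V : eqType) (s t : seq V) (F : V -> R) :
  uniq s -> uniq t -> (forall y, F y != 0 -> (y \in s) = (y \in t)) ->
  \sum_(y <- s) F y = \sum_(y <- t) F y.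
Proof.
move=> us ut st.
have nz (r : seq V) : \sum_(y <- r) F y = \sum_(y <- [seq y <- r | F y != 0]) F y.
  by rewrite big_filter [RHS]big_mkcond; apply: eq_bigr => y _; case: eqVneq.
rewrite (nz s) (nz t); apply: perm_big; apply: uniq_perm; rewrite ?filter_uniq//.
by move=> y; rewrite !mem_filter; case: (boolP (F y != 0)) => //= /st ->.
Qed.

Lemma ler_sum_sub (R : numDomainType) (V : eqType) (s t : seq V) (F : V -> R) :
  uniq s -> {subset s <= t} -> (forall y, y \in t -> 0 <= F y) ->
  \sum_(y <- s) F y <= \sum_(y <- t) F y.
Proof.
elim: s t => [|x s IH] t /=.
  by move=> _ _ F0; rewrite big_nil big_seq_cond sumr_ge0// => y /andP[/F0].
move=> /andP[xs us] st F0; have xt : x \in t by apply: st; rewrite mem_head.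
rewrite big_cons (perm_big _ (perm_to_rem xt)) big_cons lerD2l; apply: IH => //.
  move=> y ys; have /st : y \in x :: s by rewrite inE ys orbT.
  rewrite (perm_mem (perm_to_rem xt)) inE => /orP[/eqP yx|//].
  by rewrite -yx ys in xs.
by move=> y /mem_rem /F0.
Qed.

Lemma mem_zip (S T : eqType) (s : seq S) (t : seq T) y z :
  (y, z) \in zip s t -> y \in s /\ z \in t.
Proof.
elim: s t => [|a s IH] [|b t] //=.
by rewrite !inE xpair_eqE => /orP[/andP[-> ->]//|/IH[-> ->]]; rewrite !orbT.
Qed.

(** * The heat kernel of a finite reversible graph *)

Section Reversible.
Variables (R : realFieldType) (V : eqType) (B : seq V) (e : rel V).
Hypotheses (uB : uniq B) (e_sym : symmetric e).

Let c x y : R := (e x y)%:R.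
Let c_sym x y : c x y = c y x. Proof. by rewrite /c e_sym. Qed.
Let c_ge0 x y : 0 <= c x y. Proof. exact: ler0n. Qed.

Definition weight x : R := \sum_(y <- B) c x y.
(** The transition operator of the walk on the graph induced on [B]. *)
Definition average (f : V -> R) x := (\sum_(y <- B) c x y * f y) / weight x.
Definition dot f g := \sum_(x <- B) weight x * f x * g x.
(** The Dirichlet form, written as [<f, (1 - average) f>]; see [energyE] for the
    sum of squared increments over the edges. *)
Definition energy f := dot f f - dot f (average f).

Lemma weight_ge0 x : 0 <= weight x. Proof. exact: sumr_ge0. Qed.

(** The multiplied-out form also holds at isolated points, where the weight and
    all the conductances vanish. *)
Lemma weight_average f x : weight x * average f x = \sum_(y <- B) c x y * f y.
Proof.
have [w0|w0] := eqVneq (weight x) 0; last by rewrite mulrC divfK.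
rewrite w0 mul0r big_seq big1// => y yB.
move/eqP: w0; rewrite psumr_eq0// => /allP/(_ _ yB)/eqP /= ->.
by rewrite mul0r.
Qed.

Lemma dotC f g : dot f g = dot g f.
Proof. by apply: eq_bigr => x _; rewrite mulrAC. Qed.

Lemma dot_averageE f g :
  dot f (average g) = \sum_(x <- B) \sum_(y <- B) c x y * f x * g y.
Proof.
apply: eq_bigr => x _; rewrite mulrAC weight_average mulr_suml.
by apply: eq_bigr => y _; rewrite mulrAC.
Qed.

(** Reversibility: the conductances are symmetric. *)
Lemma dot_average f g : dot f (average g) = dot (average f) g.
Proof.
rewrite [RHS]dotC !dot_averageE exchange_big; apply: eq_bigr => x _.
by apply: eq_bigr => y _; rewrite c_sym mulrAC.
Qed.

Lemma dotDl f g k : dot (f \+ g) k = dot f k + dot g k.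
Proof. by rewrite /dot -big_split; apply: eq_bigr => x _ /=; ring. Qed.

Lemma dotDr f g k : dot k (f \+ g) = dot k f + dot k g.
Proof. by rewrite dotC dotDl !(dotC k). Qed.

Lemma dotBl f g k : dot (f \- g) k = dot f k - dot g k.
Proof. by rewrite /dot -sumrB; apply: eq_bigr => x _ /=; ring. Qed.

Lemma dotBr f g k : dot k (f \- g) = dot k f - dot k g.
Proof. by rewrite dotC dotBl !(dotC k). Qed.

Lemma averageD f g x : average (f \+ g) x = average f x + average g x.
Proof.
by rewrite /average -mulrDl -big_split; congr (_ / _); apply: eq_bigr => y _; rewrite mulrDr.
Qed.

Lemma averageB f g x : average (f \- g) x = average f x - average g x.
Proof.
by rewrite /average -mulrBl -sumrB; congr (_ / _); apply: eq_bigr => y _; rewrite mulrBr.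
Qed.

Lemma average_ge0 f x : (forall y, 0 <= f y) -> 0 <= average f x.
Proof.
by move=> f0; rewrite divr_ge0 ?weight_ge0// sumr_ge0// => y _; rewrite mulr_ge0.
Qed.

Lemma eq_dot f f' g g' : f =1 f' -> g =1 g' -> dot f g = dot f' g'.
Proof. by move=> ff gg; apply: eq_bigr => x _; rewrite ff gg. Qed.

Lemma eq_average f f' : f =1 f' -> average f =1 average f'.
Proof. by move=> ff x; congr (_ / _); apply: eq_bigr => y _; rewrite ff. Qed.

Lemma dot_diag f g :
  dot f g = \sum_(x <- B) \sum_(y <- B) c x y * (f x * g x).
Proof. by apply: eq_bigr => x _; rewrite -mulr_suml mulrA. Qed.

Lemma dot_sqr_sum f :
  2 * dot f f = \sum_(x <- B) \sum_(y <- B) c x y * (f x ^+ 2 + f y ^+ 2).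
Proof.
rewrite mulr_natl mulr2n {2}dot_diag exchange_big dot_diag -big_split.
apply: eq_bigr => x _; rewrite -big_split; apply: eq_bigr => y _ /=.
by rewrite (c_sym y x); ring.
Qed.

Lemma energyE f :
  2 * energy f = \sum_(x <- B) \sum_(y <- B) c x y * (f x - f y) ^+ 2.
Proof.
rewrite mulrBr dot_sqr_sum dot_averageE mulr_sumr -sumrB; apply: eq_bigr => x _.
by rewrite mulr_sumr -sumrB; apply: eq_bigr => y _; ring.
Qed.

(** The operator [1 + average] is nonnegative because its quadratic form is a sum
    of squares of [f x + f y] over the edges. *)
Lemma dot_average_geN f : 0 <= dot f f + dot f (average f).
Proof.
rewrite -(pmulr_rge0 _ (ltr0n R 2)) mulrDr dot_sqr_sum dot_averageE mulr_sumr -big_split.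
rewrite sumr_ge0// => x _; rewrite mulr_sumr -big_split sumr_ge0// => y _ /=.
have -> : c x y * (f x ^+ 2 + f y ^+ 2) + 2 * (c x y * f x * f y) =
  c x y * (f x + f y) ^+ 2 by ring.
by rewrite mulr_ge0// sqr_ge0.
Qed.

(** With [K] for the averaging operator, the difference of the two energies is
    [<(1 - K) (1 - K ^ 2) f, f>], that is, the form of [1 + K] at [(1 - K) f]. *)
Lemma energy_average_le f : energy (average f) <= energy f.
Proof.
rewrite -subr_ge0.
have -> : energy f - energy (average f) =
    dot (f \- average f) (f \- average f) + dot (f \- average f) (average (f \- average f)).
  rewrite (eq_dot (frefl (f \- average f)) (averageB f (average f))).
  rewrite !dotBl -[fun x => _]/(average f \- average (average f)) !dotBr /energy.
  by rewrite (dot_average f (average f)) (dotC (average f) f); ring.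
exact: dot_average_geN.
Qed.

(** Cauchy-Schwarz along the path.  The path is first made simple, so that no
    edge is counted twice; the factor two absorbs the choice of orientation. *)
Lemma energy_path f x p : all (mem B) (x :: p) -> path e x p ->
  (f x - f (last x p)) ^+ 2 <= (size p)%:R * (2 * energy f).
Proof.
move=> xpB xp; have E0 : 0 <= 2 * energy f.
  rewrite energyE sumr_ge0// => y _; rewrite sumr_ge0// => z _.
  by rewrite mulr_ge0// sqr_ge0.
have sz : (size (shorten x p) <= size p)%N.
  by case: (shortenP xp) => p' _ /andP[_ up'] pp'; apply: uniq_leq_size.
apply: (@le_trans _ _ ((size (shorten x p))%:R * (2 * energy f))); last first.
  by rewrite ler_wpM2r// ler_nat.
case: {sz} (shortenP xp) => {xp} q xq uq qp.
have {xpB qp} xqB : all (mem B) (x :: q).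
  by move: xpB => /= /andP[-> /allP pB]; apply/allP => y /qp /pB.
pose S := \sum_(z <- zip (belast x q) q) (f z.1 - f z.2) ^+ 2.
have SE : S <= 2 * energy f.
  rewrite energyE.
  have -> : S = \sum_(z <- zip (belast x q) q) c z.1 z.2 * (f z.1 - f z.2) ^+ 2.
    rewrite /S; elim: q x xq {uq xqB S} => [|y q IH] x /=; first by rewrite !big_nil.
    by move=> /andP[xy /IH yq]; rewrite !big_cons yq /= /c xy mul1r.
  rewrite -(big_allpairs (F := fun z => c z.1 z.2 * (f z.1 - f z.2) ^+ 2)).
  apply: ler_sum_sub.
  - apply: (@map_uniq _ _ fst); rewrite -/unzip1 unzip1_zip ?size_belast//.
    by move: uq; rewrite lastI rcons_uniq => /andP[].
  - move=> [y z] yz; apply/allpairsP; exists (y, z).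
    have := xqB; rewrite lastI all_rcons => /andP[_ /allP lB].
    have /andP[_ /allP qB] := xqB.
    by have [/lB yB /qB zB] := mem_zip yz; split.
  - by move=> z _; rewrite mulr_ge0// sqr_ge0.
(* The linear form of Cauchy-Schwarz, stable under adding an edge; the optimal
   [t] is the mean increment. *)
have lin t : 2 * t * (f x - f (last x q)) - t ^+ 2 * (size q)%:R <= S.
  rewrite /S; elim: q x {xq uq xqB S SE} => [|y q IH] x /=.
    by rewrite big_nil subrr !mulr0 subr0.
  rewrite big_cons /=; have := IH y; have := sqr_ge0 (f x - f y - t).
  by rewrite -(natr1 (size q)); nra.
have [q0|q0] := posnP (size q).
  by move: q0 => /size0nil ->; rewrite /= subrr expr0n /= mul0r.
have n0 : 0 < (size q)%:R :> R by rewrite ltr0n.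
have := le_trans (lin ((f x - f (last x q)) / (size q)%:R)) SE.
set D := f x - _; set n := (size q)%:R in n0 *.
have -> : 2 * (D / n) * D - (D / n) ^+ 2 * n = D ^+ 2 / n.
  by field; rewrite gt_eqF.
by rewrite ler_pdivrMr// mulrC.
Qed.

Definition heat o n : V -> R := iter n average (fun x => (x == o)%:R / weight o).
(** Two consecutive times are added because of parity: on a bipartite graph
    the kernel at a single time oscillates between the two classes and has large
    energy. *)
Definition heat2 o n : V -> R := heat o n \+ heat o n.+1.
Definition diag o n : R := heat2 o (2 * n) o.

Lemma energy_ge0 f : 0 <= energy f.
Proof.
rewrite -(pmulr_rge0 _ (ltr0n R 2)) energyE sumr_ge0// => y _.
by rewrite sumr_ge0// => z _; rewrite mulr_ge0// sqr_ge0.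
Qed.

Lemma heat_ge0 o n x : 0 <= heat o n x.
Proof.
elim: n x => [|n IH] x; first by rewrite divr_ge0 ?weight_ge0.
exact: average_ge0.
Qed.

Lemma diag_ge0 o n : 0 <= diag o n.
Proof. by rewrite addr_ge0 ?heat_ge0. Qed.

Lemma dot_delta o f : o \in B -> weight o != 0 -> dot (heat o 0) f = f o.
Proof.
move=> oB w0; rewrite /dot (bigD1_seq o)//= big1 ?addr0.
  by rewrite eqxx mul1r divff// mul1r.
by move=> x /negPf ->; rewrite mul0r mulr0 mul0r.
Qed.

Lemma dot_iter n f g : dot (iter n average f) g = dot f (iter n average g).
Proof. by elim: n f => [//|n IH] f; rewrite iterSr IH -dot_average -iterS. Qed.

Lemma dot_heat o w i j : o \in B -> weight o != 0 ->
  dot (heat o i) (heat w j) = heat w (i + j) o.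
Proof. by move=> oB w0; rewrite dot_iter dot_delta// /heat iterD. Qed.

Lemma heat_mass o n : o \in B -> weight o != 0 ->
  \sum_(x <- B) weight x * heat o n x = 1.
Proof.
move=> oB w0; elim: n => [|n IH].
  apply: etrans (dot_delta (fun=> 1) oB w0).
  by apply: eq_bigr => x _; rewrite mulr1.
rewrite -[RHS]IH; under eq_bigr do rewrite weight_average.
rewrite exchange_big; apply: eq_bigr => x _; rewrite -mulr_suml.
by congr (_ * _); apply: eq_bigr => y _; rewrite c_sym.
Qed.

Lemma average_heat2 o n : average (heat2 o n) =1 heat2 o n.+1.
Proof. by move=> x; rewrite averageD. Qed.

(** The return values form a decreasing sequence whose decrements are the
    energies. *)
Lemma energy_heat2 o n : o \in B -> weight o != 0 ->
  energy (heat2 o n) = diag o n - diag o n.+1.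
Proof.
move=> oB w0; rewrite /energy (eq_dot (frefl (heat2 o n)) (average_heat2 o n)).
rewrite /diag (_ : 2 * n.+1 = (n + n).+2)%N; last by lia.
rewrite (_ : 2 * n = n + n)%N; last by lia.
by rewrite /heat2 !(dotDl, dotDr) !dot_heat// !(addnS, addSn) /=; ring.
Qed.

Lemma diag_decr o n m : o \in B -> weight o != 0 -> (n <= m)%N -> diag o m <= diag o n.
Proof.
move=> oB w0; elim: m => [|m IH]; first by rewrite leqn0 => /eqP ->.
rewrite leq_eqVlt => /predU1P[->//|/IH]; apply: le_trans.
by rewrite -subr_ge0 -energy_heat2// energy_ge0.
Qed.

Lemma energy_heat2_decr o n m : (n <= m)%N -> energy (heat2 o m) <= energy (heat2 o n).
Proof.
elim: m => [|m IH]; first by rewrite leqn0 => /eqP ->.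
rewrite leq_eqVlt => /predU1P[->//|/IH]; apply: le_trans.
rewrite -(_ : energy (average (heat2 o m)) = energy (heat2 o m.+1)); first exact: energy_average_le.
by rewrite /energy; congr (_ - _); apply: eq_dot => // x;
  rewrite ?(eq_average (average_heat2 o m)) average_heat2.
Qed.

(** The energies decrease in time and telescope to at most [diag o n], so that
    each of the later ones is at most the average of [n] of them. *)
Lemma energy_heat2_le o n k : o \in B -> weight o != 0 -> (2 * n <= k)%N ->
  n%:R * energy (heat2 o k) <= diag o n.
Proof.
move=> oB w0 nk.
have tele m : \sum_(i < m) energy (heat2 o (n + i)) = diag o n - diag o (n + m).
  elim: m => [|m IH]; first by rewrite big_ord0 addn0 subrr.
  by rewrite big_ord_recr /= IH energy_heat2// addnS; ring.
apply: (@le_trans _ _ (diag o n - diag o (n + n))); last first.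
  by rewrite gerBl diag_ge0.
rewrite -tele mulr_natl -[X in _ *+ X]card_ord -sumr_const ler_sum// => i _.
by apply: energy_heat2_decr; have := ltn_ord i; lia.
Qed.

(** The off-diagonal kernel is an inner product of two kernels at about half the
    time, hence bounded by the mean of their squared norms. *)
Lemma heat_le o w n k : o \in B -> weight o != 0 -> w \in B -> weight w != 0 ->
  (2 * n <= k)%N -> 2 * heat w k o <= diag o n + diag w n.
Proof.
move=> oB o0 wB w0 nk; have kE : k = (k./2 + uphalf k)%N by lia.
have diagI v i : v \in B -> weight v != 0 -> (n <= i)%N -> dot (heat v i) (heat v i) <= diag v n.
  move=> vB v0 ni; apply: (le_trans _ (diag_decr vB v0 ni)).
  by rewrite dot_heat// addnn -mul2n lerDl heat_ge0.
rewrite kE -dot_heat//.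
apply: (@le_trans _ _ (dot (heat o k./2) (heat o k./2) +
   dot (heat w (uphalf k)) (heat w (uphalf k)))); last first.
  by rewrite lerD// diagI//; lia.
rewrite -subr_ge0; set f := heat o _; set g := heat w _.
have -> : dot f f + dot g g - 2 * dot f g = dot (f \- g) (f \- g).
  by rewrite dotBl !dotBr (dotC g f); ring.
by apply: sumr_ge0 => x _; rewrite -mulrA mulr_ge0 ?weight_ge0// -expr2 sqr_ge0.
Qed.

Lemma heat2_diff o n k r x p : o \in B -> weight o != 0 -> (2 * n <= k)%N ->
  all (mem B) (x :: p) -> path e x p -> (size p <= r)%N ->
  n%:R * (heat2 o k x - heat2 o k (last x p)) ^+ 2 <= (2 * r)%:R * diag o n.
Proof.
move=> oB w0 nk xpB xp pr; have E0 := energy_ge0 (heat2 o k).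
apply: (@le_trans _ _ (n%:R * (r%:R * (2 * energy (heat2 o k))))).
  rewrite ler_wpM2l//; apply: le_trans (energy_path _ xpB xp) _.
  by rewrite ler_wpM2r ?ler_nat// mulr_ge0.
rewrite [leLHS](_ : _ = (2 * r)%:R * (n%:R * energy (heat2 o k))).
  by rewrite ler_wpM2l// energy_heat2_le.
by rewrite natrM; ring.
Qed.

(** On-diagonal bound from a ball [S] of radius [r].  If [diag o n] exceeded
    [b], the energy bound would make the kernel at least [diag o n / 2] on all of
    [S], whereas its total mass over two consecutive times is two. *)
Lemma diag_le o n r (S : seq V) (b : R) : o \in B -> weight o != 0 -> (0 < n)%N ->
  uniq S -> {subset S <= B} -> (forall y, y \in S -> 1 <= weight y) ->
  (forall y, y \in S -> exists p, [/\ all (mem B) (o :: p), path e o p,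
      (size p <= r)%N & last o p = y]) ->
  4 <= b * (size S)%:R -> (8 * r)%:R <= b * n%:R -> diag o n <= b.
Proof.
move=> oB w0 n0 uS SB S1 Sr bS bn.
rewrite leNgt; apply/negP => bD; set D := diag o n in bD.
have b0 : 0 <= b.
  by rewrite leNgt; apply/negP => b0; have := ler0n R (size S); nra.
have n0R : 0 < n%:R :> R by rewrite ltr0n.
(* The oscillation over distance [r] is at most [D / 2], since [b < D]. *)
have half y : y \in S -> D / 2 <= heat2 o (2 * n) y.
  move=> /Sr[p [pB op pr <-]].
  have := heat2_diff oB w0 (leqnn (2 * n)) pB op pr.
  set d := D - _ => dD.
  have d2 : d ^+ 2 <= (D / 2) ^+ 2.
    rewrite -(ler_pM2l n0R); apply: le_trans dD _.
    have h : (2 * r)%:R <= b * n%:R / 4 by move: bn; rewrite !natrM; lra.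
    have D0 : 0 <= D := diag_ge0 o n.
    apply: le_trans (ler_wpM2r D0 h) _; rewrite -subr_ge0.
    have -> : n%:R * (D / 2) ^+ 2 - b * n%:R / 4 * D = n%:R * D * (D - b) / 4 by field.
    by rewrite divr_ge0// !mulr_ge0// subr_ge0 ltW.
  have D20 : 0 <= D / 2 by lra.
  have : d <= D / 2.
    apply: le_trans (ler_norm _) _; rewrite -(ler_pXn2r (n := 2))// ?nnegrE//.
    by rewrite real_normK ?num_real.
  by rewrite /d; lra.
have mass : \sum_(y <- B) weight y * heat2 o (2 * n) y = 2.
  rewrite -[2]/(1 + 1) -{1}(heat_mass (2 * n) oB w0) -(heat_mass (2 * n).+1 oB w0).
  by rewrite -big_split; apply: eq_bigr => y _ /=; rewrite -mulrDr.
have : \sum_(y <- S) D / 2 <= 2.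
  rewrite -[X in _ <= X]mass.
  apply: (@le_trans _ _ (\sum_(y <- S) (weight y * heat2 o (2 * n) y))).
    rewrite !big_seq; apply: ler_sum => y yS; apply: le_trans (half y yS) _.
    by rewrite ler_peMl ?S1// addr_ge0 ?heat_ge0.
  by apply: ler_sum_sub => // y _; rewrite mulr_ge0 ?weight_ge0// addr_ge0 ?heat_ge0.
rewrite big_const_seq count_predT iter_addr addr0 -mulr_natr => h.
have N0 : 0 < (size S)%:R :> R.
  by rewrite lt_neqAle ler0n andbT; apply/eqP => N0; move: bS; rewrite -N0 mulr0; lra.
have : b * (size S)%:R < D * (size S)%:R by rewrite ltr_pM2r.
by lra.
Qed.
End Reversible.

(** * Combs with nondecreasing teeth *)

Section CombGraph.
Variable h : nat -> nat.
Hypothesis h_mono : {homo h : m n / (m <= n)%N}.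

Implicit Types u v w x y z : int * int.

(** The comb is parametrised by an arbitrary profile [h] of tooth heights. *)
Definition vertex (v : int * int) : bool := (0 <= v.2) && (v.2 <= (h `|v.1|%N)%:Z).

Definition adj (u v : int * int) : bool :=
  [&& vertex u, vertex v &
    [&& u.2 == 0, v.2 == 0 & (v.1 == u.1 + 1) || (u.1 == v.1 + 1)] ||
    ((u.1 == v.1) && ((v.2 == u.2 + 1) || (u.2 == v.2 + 1)))].

(** Every vertex adjacent to [u] is in this list; membership does not imply
    adjacency. *)
Definition neighbours (u : int * int) : seq (int * int) :=
  [:: (u.1 - 1, u.2); (u.1 + 1, u.2); (u.1, u.2 - 1); (u.1, u.2 + 1)].

Definition deg (u : int * int) : nat := count (adj u) (neighbours u).

Lemma adj_sym : symmetric adj.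
Proof. by move=> [a b] [a' b']; rewrite /adj /=; lia. Qed.

Lemma adj_neighbours u v : adj u v -> v \in neighbours u.
Proof.
by case: u v => [a b] [a' b']; rewrite /adj !inE !xpair_eqE /=; lia.
Qed.

Lemma adj_vertex u v : adj u v -> vertex u /\ vertex v.
Proof. by case/and3P. Qed.

Lemma uniq_neighbours u : uniq (neighbours u).
Proof. by case: u => a b; rewrite /= !inE !xpair_eqE /=; lia. Qed.

Lemma adj_dist u v : adj u v -> (`|v.1| <= `|u.1|.+1)%N.
Proof. by case: u v => [a b] [a' b']; rewrite /adj /=; lia. Qed.

Lemma vertex_base a : vertex (a, 0).
Proof. by rewrite /vertex /=; lia. Qed.

Lemma deg_le4 u : (deg u <= 4)%N.
Proof. exact: count_size. Qed.

Lemma deg_gt0 u : vertex u -> (0 < deg u)%N.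
Proof.
move=> vu; rewrite -has_count; apply/hasP.
have [u0|u0] := eqVneq u.2 0.
  exists (u.1 + 1, u.2); first by rewrite !inE eqxx orbT.
  by rewrite /adj vu u0 vertex_base /= !eqxx.
exists (u.1, u.2 - 1); first by rewrite !inE eqxx !orbT.
by case: u vu u0 => a b; rewrite /adj /vertex /=; lia.
Qed.

Definition box (L : nat) : seq (int * int) :=
  [seq v <- [seq (a, b) | a <- [seq i%:Z - L%:Z | i <- iota 0 (2 * L).+1],
                          b <- [seq i%:Z | i <- iota 0 (h L).+1]] | vertex v].

Lemma uniq_box L : uniq (box L).
Proof.
apply: filter_uniq; apply: allpairs_uniq => [|| [? ?] [? ?] _ _ //].
  by rewrite map_inj_uniq ?iota_uniq// => i j; lia.
by rewrite map_inj_uniq ?iota_uniq// => i j; lia.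
Qed.

Lemma mem_box L v : (v \in box L) = vertex v && (`|v.1| <= L)%N.
Proof.
rewrite mem_filter; case: (boolP (vertex v)) => // vv; rewrite !andTb.
apply/idP/idP => [/allpairsP[[a b] [/mapP[i] + -> _ ->]]|vL].
  by rewrite mem_iota /=; lia.
apply/allpairsP.
case: v vv vL => a b vv vL; exists (a, b); split=> //.
  have {}vL : (absz a <= L)%N by []; apply/mapP; exists (absz (a + L%:Z)); rewrite ?mem_iota /=;
    lia.
have hL := h_mono (vL : (absz a <= L)%N).
have {}vv : (0 <= b) && (b <= (h (absz a))%:Z) by [].
by apply/mapP; exists `|b|%N; rewrite ?mem_iota /=; lia.
Qed.

Lemma in_box L v : vertex v -> (`|v.1| < L)%N -> v \in box L.
Proof. by rewrite mem_box => -> /ltnW. Qed.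

Definition linked r x y : Prop :=
  exists p, [/\ path adj x p, last x p = y & (size p <= r)%N].

Lemma linked_refl x : linked 0 x x.
Proof. by exists [::]. Qed.

Lemma linked_weak r s x y : (r <= s)%N -> linked r x y -> linked s x y.
Proof. by move=> rs [p [? ? pr]]; exists p; split=> //; apply: leq_trans rs. Qed.

Lemma linked_trans r s x y z : linked r x y -> linked s y z -> linked (r + s) x z.
Proof.
move=> [p [xp <- pr]] [q [yq <- qs]]; exists (p ++ q).
by rewrite cat_path xp yq last_cat size_cat leq_add.
Qed.

Lemma linked_adj x y : adj x y -> linked 1 x y.
Proof. by move=> xy; exists [:: y]; rewrite /= xy. Qed.

Lemma linked_sym r x y : linked r x y -> linked r y x.
Proof.
move=> [p [xp yE pr]]; apply: linked_weak pr _.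
elim: p x xp yE => [|z p IH] x /=; first by move=> _ ->; apply: linked_refl.
move=> /andP[xz zp] /(IH _ zp) yz; rewrite -addn1; apply: linked_trans yz _.
by apply: linked_adj; rewrite adj_sym.
Qed.

Lemma linked_up a (b b' : nat) : (b + b' <= h `|a|)%N -> linked b' (a, b%:Z) (a, (b + b')%N%:Z).
Proof.
elim: b' => [|n IH] bh; first by rewrite addn0; apply: linked_refl.
rewrite -addn1; apply: linked_trans (IH _) (linked_adj _); first by lia.
by rewrite /adj /vertex /=; lia.
Qed.

Lemma linked_right a (n : nat) : linked n (a, 0) (a + n%:Z, 0).
Proof.
elim: n => [|n IH]; first by rewrite addr0; apply: linked_refl.
rewrite -addn1; apply: linked_trans IH (linked_adj _).
by rewrite /adj /vertex /=; lia.
Qed.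

Lemma linked_dist r x y : linked r x y -> (`|y.1| <= `|x.1| + r)%N.
Proof.
move=> [p [xp <- pr]]; apply: (@leq_trans (`|x.1| + size p)%N); last by rewrite leq_add2l.
elim: p x xp {pr} => [|z p IH] x /=; first by rewrite addn0.
by move=> /andP[/adj_dist xz /IH]; lia.
Qed.

Lemma path_box L x p : vertex x -> path adj x p -> (`|x.1| + size p <= L)%N ->
  all (mem (box L)) (x :: p).
Proof.
elim: p x => [|z p IH] x vx /=; first by rewrite mem_box vx addn0 andbT => _ ->.
move=> /andP[xz zp] xL; have [_ vz] := adj_vertex xz; have xz1 := adj_dist xz.
have /= -> : all (mem (box L)) (z :: p) by apply: IH => //; clear -xz1 xL; lia.
by rewrite mem_box vx /= andbT; clear -xL; lia.
Qed.

(** These are [r] consecutive vertices, down the tooth from [w] if [w] is high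
    enough, along the base otherwise.  This is the relevant volume at times when
    the walk has not yet equilibrated on its tooth. *)
Lemma ball_short w r : vertex w -> exists S, [/\ uniq S, size S = r, all vertex S &
  forall y, y \in S -> linked (2 * r) w y].
Proof.
case: w => a b vw; pose n := `|b|%N.
have bE : b = n%:Z by move: vw; rewrite /vertex /n /=; lia.
have nh : (n <= h `|a|)%N by move: vw; rewrite /vertex /n /=; lia.
rewrite bE in vw *; have [rn|nr] := leqP r n.
  exists [seq (a, (n - i)%:Z) | i <- iota 0 r]; split.
  - rewrite map_inj_in_uniq ?iota_uniq// => i j; rewrite !mem_iota => ir jr [].
    by lia.
  - by rewrite size_map size_iota.
  - by apply/allP => y /mapP[i _ ->]; rewrite /vertex /=; lia.
  - move=> y /mapP[i]; rewrite mem_iota => ir ->; apply: linked_sym.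
    apply: (linked_weak (_ : i <= _)%N); first by lia.
    by rewrite -{2}(subnK (_ : i <= n)%N); [apply: linked_up; lia|lia].
exists [seq (a + i%:Z, 0) | i <- iota 0 r]; split.
- by rewrite map_inj_in_uniq ?iota_uniq// => i j _ _ []; lia.
- by rewrite size_map size_iota.
- by apply/allP => y /mapP[i _ ->]; apply: vertex_base.
- move=> y /mapP[i]; rewrite mem_iota => ir ->.
  apply: (linked_weak (_ : n + i <= _)%N); first by lia.
  apply: linked_trans (linked_right _ _); apply: linked_sym.
  by apply: (@linked_up a 0); lia.
Qed.

(** The teeth at distance between [r] and [2 * r] from that of [w], on the side
    leading away from the origin: there all teeth are at least as high as the
    one at [r], whatever the position of [w]. *)
Lemma ball_long w r : vertex w -> w.2 <= r%:Z -> (h r <= r)%N ->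
  exists S, [/\ uniq S, size S = (r * (h r).+1)%N, all vertex S &
  forall y, y \in S -> linked (4 * r) w y].
Proof.
case: w => a b vw /= br hr; pose n := `|b|%N.
have bE : b = n%:Z by move: vw; rewrite /vertex /n /=; lia.
have nh : (n <= h `|a|)%N by move: vw; rewrite /vertex /n /=; lia.
have far : linked n (a, b) (a, 0).
  by rewrite bE; apply: linked_sym; apply: (@linked_up a 0); lia.
(* [out i] moves away from the origin by [r + i], so its tooth is at least [h r]
   high. *)
pose out (i : nat) : int := if 0 <= a then a + (r + i)%:Z else a - (r + i)%:Z.
have hout i (t : nat) : (t <= h r)%N -> (t <= h `|out i|)%N.
  by move=> tr; apply: leq_trans tr (h_mono _); rewrite /out; case: ifP; lia.
exists [seq (out i, t%:Z) | i <- iota 0 r, t <- iota 0 (h r).+1]; split.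
- apply: allpairs_uniq; rewrite ?iota_uniq// => -[i y] [i' y'] _ _ /= [+ tt'].
  by rewrite /out; case: ifP => _ ii; congr (_, _); lia.
- by rewrite size_allpairs !size_iota.
- apply/allP => y /allpairsP[[i z] [_ + ->]]; rewrite mem_iota /= => zh.
  by rewrite /vertex /= lez_nat hout.
- move=> y /allpairsP[[i z] []]; rewrite !mem_iota /= => ir zh ->.
  apply: (linked_weak (_ : n + ((r + i) + z) <= _)%N); first by lia.
  apply: linked_trans far (linked_trans _ (@linked_up _ 0 z _)); last by apply: hout; lia.
  rewrite /out; case: ifP => _; first exact: linked_right.
  by apply: linked_sym; rewrite -{2}(subrK (r + i)%:Z a); apply: linked_right.
Qed.

End CombGraph.

(** * The random walk on a comb and its heat kernel *)

Section CombWalk.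
Variables (R : realFieldType) (h : nat -> nat).
Hypothesis h_mono : {homo h : m n / (m <= n)%N}.

Local Notation vertex := (vertex h).
Local Notation adj := (adj h).
Local Notation deg := (deg h).
Local Notation box := (box h).
Local Notation linked := (linked h).
Let adjS := @adj_sym h.
Let uB := uniq_box h.

Implicit Types u v w x y z : int * int.

Definition step (u v : int * int) : R := (adj u v)%:R / (deg u)%:R.

Definition transition (f : int * int -> R) u : R := \sum_(v <- neighbours u) step u v * f v.

Lemma degE u : (deg u)%:R = \sum_(v <- neighbours u) (adj u v)%:R :> R.
Proof. by rewrite /deg -sum1_count big_mkcond natr_sum; apply: eq_bigr => v _; case: (adj u v). Qed.

Lemma step_ge0 u v : 0 <= step u v.
Proof. by rewrite divr_ge0. Qed.

Lemma sum_step u : vertex u -> \sum_(v <- neighbours u) step u v = 1.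
Proof. by move=> vu; rewrite -mulr_suml -degE divff// pnatr_eq0 -lt0n deg_gt0. Qed.

Lemma transition_le f g u :
  (forall v, adj u v -> f v <= g v) -> transition f u <= transition g u.
Proof.
move=> fg; apply: ler_sum => v _; rewrite /step.
by case: (boolP (adj u v)) => [/fg|_]; [apply: ler_wpM2l; rewrite divr_ge0|rewrite !mul0r].
Qed.

Lemma eq_transition f g u :
  (forall v, adj u v -> f v = g v) -> transition f u = transition g u.
Proof. by move=> fg; apply/eqP; rewrite eq_le !transition_le// => v /fg ->. Qed.

Lemma transition_cst k u : vertex u -> transition (fun=> k) u = k.
Proof. by move=> vu; rewrite /transition -mulr_suml sum_step// mul1r. Qed.

Lemma transition_sum (I : Type) (s : seq I) (F : I -> int * int -> R) u :
  transition (fun v => \sum_(i <- s) F i v) u = \sum_(i <- s) transition (F i) u.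
Proof.
rewrite /transition exchange_big; apply: eq_bigr => v _.
by rewrite mulr_sumr.
Qed.

Lemma transitionZ k f u : transition (fun v => k * f v) u = k * transition f u.
Proof. by rewrite /transition mulr_sumr; apply: eq_bigr => v _; rewrite mulrCA. Qed.

Lemma transitionD f g u : transition (fun v => f v + g v) u = transition f u + transition g u.
Proof. by rewrite /transition -big_split; apply: eq_bigr => v _; rewrite mulrDr. Qed.

Lemma transition_ge0 f u : (forall v, 0 <= f v) -> 0 <= transition f u.
Proof. by move=> f0; apply: sumr_ge0 => v _; rewrite mulr_ge0 ?step_ge0. Qed.

Lemma sum_box_neighbours L x (f : int * int -> R) : (`|x.1| < L)%N ->
  \sum_(y <- box L) (adj x y)%:R * f y = \sum_(y <- neighbours x) (adj x y)%:R * f y.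
Proof.
move=> xL; apply: eq_big_support => [||y]; rewrite ?uB ?uniq_neighbours//.
case: (boolP (adj x y)) => [xy _|]; last by rewrite mul0r eqxx.
rewrite (adj_neighbours xy) (mem_box h_mono) (proj2 (adj_vertex xy)) andTb.
exact: leq_trans (adj_dist xy) xL.
Qed.

Lemma weight_box L x : (`|x.1| < L)%N -> weight R (box L) adj x = (deg x)%:R.
Proof.
move=> xL; rewrite degE; have := sum_box_neighbours (fun=> 1) xL.
by under eq_bigr do rewrite mulr1; under [RHS]eq_bigr do rewrite mulr1.
Qed.

Lemma transition_box L f x : (`|x.1| < L)%N -> transition f x = average (box L) adj f x.
Proof.
move=> xL; rewrite /average weight_box// sum_box_neighbours// /transition mulr_suml.
by apply: eq_bigr => y _; rewrite /step mulrAC.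
Qed.

(** Away from the boundary of a box the degrees, and hence the transition
    probabilities, are those of the whole comb, and in [n] steps the boundary is
    not reached. *)
Lemma iter_transition_box L f g n x : (forall y, (`|y.1| <= L)%N -> f y = g y) ->
  (`|x.1| + n <= L)%N -> iter n transition f x = iter n (average (box L) adj) g x.
Proof.
move=> fg; elim: n x => [|n IH] x xL; first by apply: fg; rewrite addn0 in xL.
rewrite !iterS -transition_box; last by lia.
by apply: eq_transition => y xy; apply: IH; have := adj_dist xy; lia.
Qed.

(** The transition probability from [x] to [w] in [n] steps, divided by the
    degree of [w], as a function of [x]. *)
Definition comb_heat w n : int * int -> R :=
  iter n transition (fun y => (y == w)%:R / (deg w)%:R).

Definition comb_heat2 w n x : R := comb_heat w n x + comb_heat w n.+1 x.

Definition comb_diag w n : R := comb_heat2 w (2 * n) w.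

Lemma comb_heat_box L w n x : (`|w.1| < L)%N -> (`|x.1| + n <= L)%N ->
  comb_heat w n x = heat R (box L) adj w n x.
Proof. by move=> wL; apply: iter_transition_box => y _; rewrite weight_box. Qed.

Lemma comb_heat_ge0 w n x : 0 <= comb_heat w n x.
Proof.
elim: n x => [|n IH] x; first by rewrite divr_ge0.
exact: transition_ge0.
Qed.

Lemma weight_box_neq0 L x : vertex x -> (`|x.1| < L)%N -> weight R (box L) adj x != 0.
Proof. by move=> vx xL; rewrite weight_box// pnatr_eq0 -lt0n deg_gt0. Qed.

Lemma comb_diagE L w n : (`|w.1| + (2 * n).+1 <= L)%N ->
  comb_diag w n = diag R (box L) adj w n.
Proof.
move=> wL; rewrite /comb_diag /comb_heat2 (@comb_heat_box L) ?(@comb_heat_box L w (2 * n).+1);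
  try by lia.
by [].
Qed.

Lemma comb_heat_le v w n k : vertex v -> vertex w -> (2 * n <= k)%N ->
  2 * comb_heat w k v <= comb_diag v n + comb_diag w n.
Proof.
move=> vv vw nk.
have [L wL vL] : exists2 L, (`|w.1| + k + (2 * n).+1 < L)%N & (`|v.1| + k + (2 * n).+1 < L)%N.
  by exists (`|w.1| + `|v.1| + k + (2 * n).+2)%N; lia.
rewrite (@comb_diagE L v) ?(@comb_diagE L w) ?(@comb_heat_box L); try by lia.
have {}wL : (`|w.1| < L)%N by lia.
have {}vL : (`|v.1| < L)%N by lia.
by apply: heat_le; rewrite ?weight_box_neq0 ?(in_box h_mono).
Qed.

Lemma comb_heat2_diff w n k r x y : vertex w -> vertex x -> (2 * n <= k)%N -> linked r x y ->
  n%:R * (comb_heat2 w k x - comb_heat2 w k y) ^+ 2 <= (2 * r)%:R * comb_diag w n.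
Proof.
move=> vw vx nk xy; have yr := linked_dist xy; case: xy => p [xp yE pr].
have [L wL xL] : exists2 L, (`|w.1| + (2 * n).+1 < L)%N & (`|x.1| + r + k.+1 < L)%N.
  by exists (`|w.1| + `|x.1| + r + k + (2 * n)).+3; lia.
rewrite /comb_heat2 (@comb_diagE L) ?(@comb_heat_box L); try by lia.
rewrite -yE.
have {}wL : (`|w.1| < L)%N by lia.
have {}xL : (`|x.1| + size p <= L)%N by lia.
by apply: heat2_diff; rewrite ?weight_box_neq0 ?(in_box h_mono) ?(path_box h_mono).
Qed.

Lemma comb_diag_le w n r (S : seq (int * int)) (b : R) : vertex w -> (0 < n)%N ->
  uniq S -> all vertex S -> (forall y, y \in S -> linked r w y) ->
  4 <= b * (size S)%:R -> (8 * r)%:R <= b * n%:R -> comb_diag w n <= b.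
Proof.
move=> vw n0 uS /allP vS Sr; have [L wL] : exists L, (`|w.1| + r + (2 * n).+1 < L)%N.
  by exists (`|w.1| + r + (2 * n)).+2; lia.
have Sd y : y \in S -> (`|y.1| < L)%N by move=> /Sr /linked_dist; lia.
rewrite (@comb_diagE L); last by lia.
apply: diag_le => //.
- by rewrite (in_box h_mono)//; lia.
- by rewrite weight_box_neq0//; lia.
- by move=> y yS; rewrite (in_box h_mono) ?vS ?Sd.
- by move=> y yS; rewrite weight_box ?Sd// ler1n deg_gt0// vS.
- move=> y /Sr [p [wp pE pr]]; exists p; split=> //.
  by rewrite (path_box h_mono)//; lia.
Qed.

Lemma comb_diag_short w r : vertex w -> (0 < r)%N -> comb_diag w (r ^ 2) <= 16 / r%:R.
Proof.
move=> vw r0; have [S [uS sS vS Sr]] := ball_short r vw.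
have R0 : r%:R != 0 :> R by rewrite pnatr_eq0 -lt0n.
apply: comb_diag_le uS vS Sr _ _; rewrite ?expn_gt0 ?r0// ?sS.
  by rewrite divfK//; lra.
by rewrite !(natrX, natrM) le_eqVlt; apply/orP; left; apply/eqP; field.
Qed.

Lemma comb_diag_long w r : vertex w -> (0 < r)%N -> w.2 <= r%:Z -> (h r <= r)%N ->
  comb_diag w (r ^ 2 * (h r).+1) <= 32 / (r * (h r).+1)%:R.
Proof.
move=> vw r0 wr hr; have [S [uS sS vS Sr]] := ball_long h_mono vw wr hr.
have R0 : r%:R != 0 :> R by rewrite pnatr_eq0 -lt0n.
have H0 : (h r).+1%:R != 0 :> R by rewrite pnatr_eq0.
apply: comb_diag_le uS vS Sr _ _; rewrite ?muln_gt0 ?expn_gt0 ?r0// ?sS.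
  by rewrite divfK//; [lra|rewrite natrM mulf_neq0].
rewrite !(natrX, natrM) le_eqVlt; apply/orP; left; apply/eqP.
by move: R0 H0; move: (h r).+1%:R r%:R => A x R0 H0; field; rewrite R0 H0.
Qed.

(** The probability of moving from [x] to [w] in [n] steps. *)
Definition trans_prob n x w : R := iter n transition (fun y => (y == w)%:R) x.

Lemma iter_transition_ext n f g x : (forall y, f y = g y) ->
  iter n transition f x = iter n transition g x.
Proof. by move=> fg; elim: n x => [|n IH] x //=; apply: eq_transition => y _. Qed.

Lemma trans_probE n x w : vertex w -> trans_prob n x w = (deg w)%:R * comb_heat w n x.
Proof.
move=> vw; elim: n x => [|n IH] x.
  by rewrite /trans_prob /comb_heat /= mulrC divfK// pnatr_eq0 -lt0n deg_gt0.
by rewrite /trans_prob /comb_heat !iterS -transitionZ; apply: eq_transition => y _; apply: IH.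
Qed.

Lemma trans_prob_ge0 n x w : 0 <= trans_prob n x w.
Proof. by elim: n x => [|n IH] x; [rewrite ler0n|apply: transition_ge0]. Qed.

Lemma iter_transition_sum n (I : Type) (s : seq I) (F : I -> int * int -> R) x :
  iter n transition (fun v => \sum_(i <- s) F i v) x = \sum_(i <- s) iter n transition (F i) x.
Proof.
elim: n x => [//|n IH] x; rewrite iterS -transition_sum.
by apply: eq_transition => y _; rewrite IH.
Qed.

Lemma iter_transition_le n f g x : vertex x -> (forall y, vertex y -> f y <= g y) ->
  iter n transition f x <= iter n transition g x.
Proof.
move=> + fg; elim: n x => [|n IH] x vx; first exact: fg.
by apply: transition_le => y /adj_vertex[_ /IH].
Qed.

Lemma iter_transition_cst n k x : vertex x -> iter n transition (fun=> k) x = k.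
Proof.
elim: n x => [//|n IH] x vx; rewrite iterS -[RHS](transition_cst k vx).
by apply: eq_transition => y /adj_vertex[_ /IH].
Qed.

Lemma sum_indic (s : seq (int * int)) y : uniq s ->
  \sum_(w <- s) (y == w)%:R = (y \in s)%:R :> R.
Proof.
move=> us; rewrite -natr_sum; congr (_%:R).
rewrite (eq_bigr (fun w => if w == y then 1%N else 0%N)); last first.
  by move=> w _; rewrite eq_sym; case: eqP.
by rewrite -big_mkcond sum1_count count_uniq_mem.
Qed.

Lemma sum_trans_prob n x (s : seq (int * int)) : uniq s ->
  \sum_(w <- s) trans_prob n x w = iter n transition (fun y => (y \in s)%:R) x.
Proof.
by move=> us; rewrite -iter_transition_sum; apply: iter_transition_ext => y; apply: sum_indic.
Qed.

Lemma sum_trans_prob_le1 n x s : uniq s -> vertex x -> \sum_(w <- s) trans_prob n x w <= 1.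
Proof.
move=> us vx; rewrite sum_trans_prob// -[leRHS](iter_transition_cst n 1 vx).
by apply: iter_transition_le => // y _; rewrite lern1 leq_b1.
Qed.

Definition parity (v : int * int) : bool := odd (`|v.1| + `|v.2|).

Lemma adj_parity u v : adj u v -> parity v = ~~ parity u.
Proof. by case: u v => [a b] [a' b']; rewrite /adj /parity /=; lia. Qed.

(** Combs are bipartite. *)
Lemma comb_heat_parity w n x : parity x (+) parity w != odd n -> comb_heat w n x = 0.
Proof.
elim: n x => [|n IH] x /=.
  by rewrite /comb_heat /=; case: (x =P w) => [->|_ _]; rewrite ?addbb// mul0r.
move=> xw; apply: etrans (_ : transition (fun=> 0) x = 0).
  apply: eq_transition => y xy; apply: IH; rewrite (adj_parity xy).
  by move: xw; case: (parity x); case: (parity w); case: (odd n).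
by rewrite /transition big1// => v _; rewrite mulr0.
Qed.

(** For starting points of equal parity the sum over two consecutive times has
    only one nonzero term, the same for both points, so oscillation bounds for
    [comb_heat2] apply to the kernel itself. *)
Lemma comb_heat_diff w n x y : parity x = parity y ->
  comb_heat w n x - comb_heat w n y = 0 \/
  comb_heat w n x - comb_heat w n y = comb_heat2 w n x - comb_heat2 w n y.
Proof.
move=> xy; have [e|ne] := eqVneq (parity x (+) parity w) (odd n).
  have odd0 z : parity z = parity x -> comb_heat w n.+1 z = 0.
    by move=> zx; apply: comb_heat_parity; rewrite zx e /=; case: (odd n).
  by right; rewrite /comb_heat2 !odd0// !addr0.
by left; rewrite !comb_heat_parity ?subrr// -xy.
Qed.
End CombWalk.

(** * Confinement of the walk *)

Section Confine.
Variables (R : realFieldType) (h : nat -> nat).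
Hypothesis h_mono : {homo h : m n / (m <= n)%N}.
Implicit Types u v w x y z : int * int.
Local Notation vertex := (vertex h).
Local Notation adj := (adj h).
Local Notation deg := (deg h).
Local Notation box := (box h).
Local Notation linked := (linked h).
Local Notation transition := (@transition R h).

(** The transition operator, with the adjacency conditions at the base and at the
    tip of a tooth made explicit. *)
Lemma transitionE f a (b : nat) : (b <= h `|a|)%N -> (deg (a, b%:Z))%:R * transition f (a, b%:Z) =
  (b == 0%N)%:R * (f (a - 1, b%:Z) + f (a + 1, b%:Z)) + (b != 0%N)%:R * f (a, b%:Z - 1) +
  (b < h `|a|)%N%:R * f (a, b%:Z + 1).
Proof.
move=> bh; rewrite /transition mulr_sumr.
rewrite (eq_bigr (fun v => (adj (a, b%:Z) v)%:R * f v)); last first.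
  move=> v _; rewrite /step mulrCA mulrA divfK//.
  by rewrite pnatr_eq0 -lt0n deg_gt0// /vertex /=; lia.
rewrite !big_cons big_nil addr0 /=.
have -> : adj (a, b%:Z) (a - 1, b%:Z) = (b == 0%N) by rewrite /adj /vertex /=; lia.
have -> : adj (a, b%:Z) (a + 1, b%:Z) = (b == 0%N) by rewrite /adj /vertex /=; lia.
have -> : adj (a, b%:Z) (a, b%:Z - 1) = (b != 0%N) by rewrite /adj /vertex /=; lia.
have -> : adj (a, b%:Z) (a, b%:Z + 1) = (b < h `|a|)%N by rewrite /adj /vertex /=; lia.
by ring.
Qed.

Lemma deg_natE a (b : nat) : (b <= h `|a|)%N ->
  (deg (a, b%:Z))%:R = (b == 0%N)%:R * 2 + (b != 0%N)%:R + (b < h `|a|)%N%:R :> R.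
Proof.
move=> bh; have := transitionE (fun=> 1) bh.
rewrite transition_cst; last by rewrite /vertex /=; lia.
by rewrite !mulr1 => ->.
Qed.

Variable r : nat.
Hypothesis r_gt0 : (0 < r)%N.
Let A := (h r).+1.

Definition excess (a : int) : nat := (`|a| - r)%N.

(** An approximation from below of the expected exit time from a horizontal
    interval.  On a tooth, [2 h b - b ^ 2] is the expected time to return to the
    base from height [b].  Along the base, a visit to a tooth of height [h]
    makes the second difference [- 2 (h + 1)] admissible; it is used at distance
    at least [r], where the teeth have height at least [h r], and the base profile
    is flat nearer to the origin. *)
Definition barrier u : R :=
  A%:R * (r%:R ^+ 2 - (excess u.1)%:R ^+ 2) +
  (2 * (h `|u.1|)%:R * u.2%:~R - u.2%:~R ^+ 2).

(** The square of the excess over [r] has second difference at most two, and zero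
    where the excess vanishes on both sides. *)
Lemma excess_convex a :
  (excess (a - 1) ^ 2 + excess (a + 1) ^ 2 <= 2 * excess a ^ 2 + 2 * (r <= `|a|))%N.
Proof.
have sq t : (t.+1 ^ 2 + t.-1 ^ 2 <= 2 * t ^ 2 + 2)%N.
  by case: t => [|t] //; rewrite /= -!mulnn; nia.
have [ra|ra] := leqP r `|a|; last first.
  have -> : excess (a - 1) = 0%N by rewrite /excess; lia.
  by have -> : excess (a + 1) = 0%N by rewrite /excess; lia.
have [a0|a0] := leP 0 a.
  have -> : excess (a - 1) = (excess a).-1 by clear sq; rewrite /excess; lia.
  have -> : excess (a + 1) = (excess a).+1 by clear sq; rewrite /excess; lia.
  by rewrite addnC sq.
have -> : excess (a - 1) = (excess a).+1 by clear sq; rewrite /excess; lia.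
have -> : excess (a + 1) = (excess a).-1 by clear sq; rewrite /excess; lia.
by rewrite sq.
Qed.

(** Inside a tooth and at its tip this is an equality.  At the base it reduces to
    the bound on the second difference of the base profile, where the height [h]
    of the tooth pays for the factor [h r + 1]. *)
Lemma transition_barrier u : vertex u -> barrier u - 1 <= transition barrier u.
Proof.
case: u => a b' vu; have [b bE] : exists b : nat, b' = b%:Z.
  by exists `|b'|%N; move: vu; rewrite /vertex /=; lia.
rewrite {b'}bE in vu *; have bh : (b <= h `|a|)%N by move: vu; rewrite /vertex /=; lia.
have d0 : 0 < (deg (a, b%:Z))%:R :> R by rewrite ltr0n deg_gt0.
rewrite -(ler_pM2l d0) transitionE// deg_natE// /barrier /=.
have [b0|b0] := eqVneq b 0%N; last first.
  have b1 : (b%:Z - 1)%:~R = b%:R - 1 :> R by rewrite rmorphB.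
  have b2 : (b%:Z + 1)%:~R = b%:R + 1 :> R by rewrite rmorphD.
  rewrite b1 b2 -[b%:~R]/(b%:R : R) /= !mul0r !add0r mul1r; case: ltnP => hb /=.
    by rewrite -subr_ge0 le_eqVlt; apply/orP; left; apply/eqP; ring.
  have -> : h `|a| = b by lia.
  by rewrite -subr_ge0 le_eqVlt; apply/orP; left; apply/eqP; ring.
have /= := excess_convex a; rewrite -(ler_nat R) !(natrD, natrX, natrM) => cv.
have Ah : A%:R * (r <= `|a|)%N%:R <= (h `|a|)%:R + 1 :> R.
  case: leqP => [/h_mono ra|_]; last by rewrite mulr0; have := ler0n R (h `|a|); lra.
  by rewrite mulr1 natr1 ler_nat /A ltnS.
have A0 : 0 <= A%:R :> R by rewrite ler0n.
rewrite b0 /= !mul1r !mul0r.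
have -> : (0 + 1)%:~R = 1 :> R by rewrite add0r.
have key : A%:R * ((excess (a - 1))%:R ^+ 2 + (excess (a + 1))%:R ^+ 2 - 2 * (excess a)%:R ^+ 2) <=
   2 * (h `|a|)%:R + 2 :> R.
  apply: (@le_trans _ _ (A%:R * (2 * (r <= `|a|)%N%:R))); last by lra.
  by apply: ler_wpM2l => //; lra.
case: ltnP => hb /=; first by lra.
have h0 : h `|a| = 0%N by lia.
by rewrite h0 in key *; lra.
Qed.

Lemma iter_transition_barrier n u : vertex u -> barrier u - n%:R <= iter n transition barrier u.
Proof.
elim: n u => [|n IH] u vu /=; first by rewrite subr0.
apply: (@le_trans _ _ (transition (fun v => barrier v + - n%:R) u)).
  by rewrite transitionD transition_cst// -natr1; have := transition_barrier vu; lra.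
by apply: transition_le => v /adj_vertex[_ /IH].
Qed.

Hypothesis h_small : forall n, (r <= n)%N -> (16 * h n <= n)%N.

Lemma barrier_ge u : vertex u -> (`|u.1| <= r)%N -> A%:R * r%:R ^+ 2 <= barrier u.
Proof.
case: u => a b' vu /= ar; have [b bE] : exists b : nat, b' = b%:Z.
  by exists `|b'|%N; move: vu; rewrite /vertex /=; lia.
rewrite {b'}bE in vu *; have bh : (b <= h `|a|)%N by move: vu; rewrite /vertex /=; lia.
rewrite /barrier /excess /= (_ : `|a| - r = 0)%N; last by lia.
rewrite expr0n subr0 lerDl -(ler_nat R) in bh *.
rewrite -[b%:~R]/(b%:R : R); have := ler0n R b; nra.
Qed.

(** Beyond [4 * r] the quadratic decrease of the base profile dominates the
    contribution of the teeth, so that [barrier] is nonpositive there. *)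
Lemma barrier_le u : vertex u ->
  barrier u <= 2 * A%:R * r%:R ^+ 2 * (u \in box (4 * r))%:R.
Proof.
move=> vu; rewrite mem_box// vu andTb.
case: u vu => a b' vu /=; have [b bE] : exists b : nat, b' = b%:Z.
  by exists `|b'|%N; move: vu; rewrite /vertex /=; lia.
rewrite {b'}bE in vu *; have bh : (b <= h `|a|)%N by move: vu; rewrite /vertex /=; lia.
rewrite /barrier /=; have A1 : 1 <= A%:R :> R by rewrite ler1n.
apply: (@le_trans _ _ (A%:R * (r%:R ^+ 2 - (excess a)%:R ^+ 2) + (h `|a|)%:R ^+ 2)).
  by rewrite lerD2l; have := sqr_ge0 ((h `|a|)%:R - b%:R : R); rewrite -[b%:~R]/(b%:R : R); nra.
have [ar|ar] := leqP `|a| (4 * r).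
  have hr : (h `|a| <= r)%N.
    by apply: leq_trans (h_mono ar) _; have := @h_small (4 * r)%N; lia.
  have e0 : 0 <= A%:R * (excess a)%:R ^+ 2 :> R by rewrite mulr_ge0// sqr_ge0.
  have : (h `|a|)%:R ^+ 2 <= r%:R ^+ 2 :> R by rewrite -!natrX ler_nat leq_sqr.
  have : r%:R ^+ 2 <= A%:R * r%:R ^+ 2 :> R by rewrite ler_peMl// sqr_ge0.
  by rewrite mulr1; lra.
rewrite mulr0; have hs : (16 * h `|a| <= `|a|)%N by apply: h_small; lia.
have eE : (excess a)%:R = `|a|%N%:R - r%:R :> R by rewrite /excess natrB//; lia.
have h2 : (h `|a|)%:R ^+ 2 <= (excess a)%:R ^+ 2 - r%:R ^+ 2 :> R.
  move: hs ar; rewrite eE -(ltr_nat R) -(ler_nat R) !natrM.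
  by have := ler0n R (h `|a|); have := ler0n R r; nra.
have : (excess a)%:R ^+ 2 - r%:R ^+ 2 <= A%:R * ((excess a)%:R ^+ 2 - r%:R ^+ 2) :> R.
  by rewrite ler_peMl//; apply: le_trans h2; rewrite sqr_ge0.
by lra.
Qed.

(** The barrier starts at [(h r + 1) * r ^ 2] or more and its expectation loses at
    most half of this in [k] steps.  As it is at most twice this value on the box
    and nonpositive elsewhere, the box has probability at least one quarter. *)
Lemma confine x k : vertex x -> (`|x.1| <= r)%N -> (2 * k <= r ^ 2 * (h r).+1)%N ->
  1 / 4 <= \sum_(w <- box (4 * r)) trans_prob R h k x w.
Proof.
move=> vx xr kr; rewrite sum_trans_prob ?uniq_box//; set p := iter _ _ _ x.
have Ar0 : 0 < A%:R * r%:R ^+ 2 :> R by rewrite mulr_gt0 ?exprn_gt0 ?ltr0n.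
have up : iter k transition barrier x <= 2 * A%:R * r%:R ^+ 2 * p.
  have -> : 2 * A%:R * r%:R ^+ 2 * p =
     iter k transition (fun y => 2 * A%:R * r%:R ^+ 2 * (y \in box (4 * r))%:R) x.
    rewrite /p; elim: (k) x {vx xr p} => [//|n IH] x; rewrite !iterS -transitionZ.
    by apply: eq_transition => y _; rewrite IH.
  exact: iter_transition_le barrier_le.
have lo := le_trans (lerD (barrier_ge vx xr) (lexx (- k%:R))) (iter_transition_barrier k vx).
have : 2 * k%:R <= A%:R * r%:R ^+ 2 :> R.
  by move: kr; rewrite -(ler_nat R) !(natrX, natrM) [leRHS]mulrC.
by have := le_trans lo up; rewrite -(ler_pM2l Ar0); nra.
Qed.
End Confine.

(** * Heat kernel bounds at dyadic scales *)

(** The number of vertices of a tooth at distance [2 ^ j] from the origin. *)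
Definition tooth_size (h : nat -> nat) (j : nat) : nat := (h (2 ^ j)%N).+1.

Section Scales.
Variables (R : realFieldType) (h : nat -> nat).
Hypothesis h_mono : {homo h : m n / (m <= n)%N}.
Implicit Types u v w x y z : int * int.
Local Notation vertex := (vertex h).
Local Notation adj := (adj h).
Local Notation deg := (deg h).
Local Notation box := (box h).
Local Notation linked := (linked h).
Local Notation comb_heat := (@comb_heat R h).
Local Notation comb_heat2 := (@comb_heat2 R h).
Local Notation comb_diag := (@comb_diag R h).
Local Notation trans_prob := (@trans_prob R h).
Local Notation tooth_size := (tooth_size h).

Lemma tooth_size_mono i j : (i <= j)%N -> (tooth_size i <= tooth_size j)%N.
Proof. by move=> ij; rewrite /tooth_size ltnS; apply: h_mono; rewrite leq_exp2l. Qed.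

Lemma expn4 i : (4 ^ i = (2 ^ i) ^ 2)%N.
Proof. by rewrite -expnM mulnC expnM. Qed.

Lemma exprn4 i : 4 ^+ i = 2 ^+ i ^+ 2 :> R.
Proof. by rewrite -!natrX expn4. Qed.

(** Radius [2 ^ j], ball of size [2 ^ j * tooth_size j], time radius times
    size. *)
Lemma comb_diag_level w j : vertex w -> w.2 <= (2 ^ j)%N%:Z -> (h (2 ^ j)%N <= 2 ^ j)%N ->
  comb_diag w (4 ^ j * tooth_size j) <= 32 / (2 ^+ j * (tooth_size j)%:R).
Proof.
move=> vw wj hj; have := comb_diag_long R h_mono vw (expn_gt0 2 j) wj hj.
by rewrite expn4 /tooth_size natrM natrX.
Qed.

Lemma comb_heat_level v w j k : vertex v -> vertex w -> v.2 <= (2 ^ j)%N%:Z ->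
  w.2 <= (2 ^ j)%N%:Z -> (h (2 ^ j)%N <= 2 ^ j)%N -> (2 * (4 ^ j * tooth_size j) <= k)%N ->
  comb_heat w k v <= 32 / (2 ^+ j * (tooth_size j)%:R).
Proof.
move=> vv vw vj wj hj kj; have := comb_heat_le R h_mono vv vw kj.
by have := comb_diag_level vv vj hj; have := comb_diag_level vw wj hj; lra.
Qed.

Lemma comb_heat_level_short v w i k : vertex v -> vertex w -> (2 * 4 ^ i <= k)%N ->
  comb_heat w k v <= 16 / 2 ^+ i.
Proof.
move=> vv vw ki; have i0 := expn_gt0 2 i.
rewrite expn4 in ki; have := comb_heat_le R h_mono vv vw ki.
have := comb_diag_short R h_mono vv i0; have := comb_diag_short R h_mono vw i0.
by rewrite natrX; lra.
Qed.

Lemma trans_prob_level v w j k : vertex v -> vertex w -> v.2 <= (2 ^ j)%N%:Z ->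
  w.2 <= (2 ^ j)%N%:Z -> (h (2 ^ j)%N <= 2 ^ j)%N -> (2 * (4 ^ j * tooth_size j) <= k)%N ->
  trans_prob k v w <= 128 / (2 ^+ j * (tooth_size j)%:R).
Proof.
move=> vv vw vj wj hj kj; rewrite trans_probE//; have := comb_heat_level vv vw vj wj hj kj.
have := comb_heat_ge0 R h w k v; have : (deg w)%:R <= 4 :> R by rewrite ler_nat deg_le4.
set b := _ / _; rewrite (_ : 128 / _ = 4 * b); last by rewrite /b mulrA -natrM.
move=> d4 g0 gb; apply: (@le_trans _ _ (4 * comb_heat w k v)).
  by apply: ler_wpM2r d4.
by rewrite ler_pM2l.
Qed.

Lemma trans_prob_level_short v w i k : vertex v -> vertex w -> (2 * 4 ^ i <= k)%N ->
  trans_prob k v w <= 64 / 2 ^+ i.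
Proof.
move=> vv vw ki; rewrite trans_probE//; have := comb_heat_level_short vv vw ki.
have := comb_heat_ge0 R h w k v; have : (deg w)%:R <= 4 :> R by rewrite ler_nat deg_le4.
set b := _ / _; rewrite (_ : 64 / _ = 4 * b); last by rewrite /b mulrA -natrM.
move=> d4 g0 gb; apply: (@le_trans _ _ (4 * comb_heat w k v)).
  by apply: ler_wpM2r d4.
by rewrite ler_pM2l.
Qed.

(** For [L] large enough, the probability that three independent walks started
    at [x], [y], [z] are at the same vertex at time [k]. *)
Definition collision L k x y z : R :=
  \sum_(w <- box L) trans_prob k x w * trans_prob k y w * trans_prob k z w.

Lemma collision_ge0 L k x y z : 0 <= collision L k x y z.
Proof. by apply: sumr_ge0 => w _; rewrite !mulr_ge0 ?trans_prob_ge0. Qed.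

(** Two of the three factors are bounded uniformly, the third sums to at most
    one. *)
Lemma collision_le L k v b : vertex v -> (forall w, w \in box L -> trans_prob k v w <= b) ->
  collision L k v v v <= b ^+ 2.
Proof.
move=> vv vb; apply: (@le_trans _ _ (\sum_(w <- box L) b ^+ 2 * trans_prob k v w)).
  rewrite /collision !big_seq; apply: ler_sum => w wL; have p0 := trans_prob_ge0 R h k v w.
  by rewrite ler_wpM2r// -expr2 ler_pXn2r ?nnegrE ?vb// (le_trans p0)// vb.
rewrite -mulr_sumr ler_piMr ?sqr_ge0//.
by rewrite sum_trans_prob_le1 ?uniq_box.
Qed.

Lemma collision_level L j k v : vertex v -> (`|v.1| <= L)%N -> (h L <= 2 ^ j)%N ->
  (h (2 ^ j)%N <= 2 ^ j)%N -> (2 * (4 ^ j * tooth_size j) <= k)%N ->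
  collision L k v v v <= 128 ^+ 2 / (4 ^+ j * (tooth_size j)%:R ^+ 2).
Proof.
move=> vv vL hL hj kj.
have short w : vertex w -> (`|w.1| <= L)%N -> w.2 <= (2 ^ j)%N%:Z.
  by case: w => a b /andP[/= b0 ba] /h_mono /= wh; lia.
apply: (@le_trans _ _ ((128 / (2 ^+ j * (tooth_size j)%:R)) ^+ 2)).
  apply: collision_le => // w; rewrite mem_box// => /andP[vw wL].
  by apply: trans_prob_level => //; apply: short.
by rewrite expr_div_n exprMn -exprn4.
Qed.

Lemma collision_level_short L i k v : vertex v -> (2 * 4 ^ i <= k)%N ->
  collision L k v v v <= 64 ^+ 2 / 4 ^+ i.
Proof.
move=> vv ki; apply: (@le_trans _ _ ((64 / 2 ^+ i) ^+ 2)).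
  by apply: collision_le => // w; rewrite mem_box// => /andP[vw _]; apply: trans_prob_level_short.
by rewrite expr_div_n -exprn4.
Qed.

Lemma collision_le1 L k v : vertex v -> collision L k v v v <= 1.
Proof.
move=> vv; rewrite -[1](expr1n _ 2); apply: collision_le => // w _.
by have := sum_trans_prob_le1 R k (s := [:: w]) isT vv; rewrite big_seq1.
Qed.

(** The tangent inequality for the cube, summed; with [t] the mean of [q] it is
    the power mean inequality. *)
Lemma sum_cube_ge (I : Type) (s : seq I) (q : I -> R) (t : R) : 0 <= t ->
  (forall i, 0 <= q i) ->
  3 * t ^+ 2 * (\sum_(i <- s) q i) - 2 * t ^+ 3 * (size s)%:R <= \sum_(i <- s) q i ^+ 3.
Proof.
move=> t0 q0; elim: s => [|i s IH]; first by rewrite !big_nil !mulr0 subr0.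
rewrite !big_cons /= -natr1.
have : 3 * t ^+ 2 * q i - 2 * t ^+ 3 <= q i ^+ 3.
  rewrite -subr_ge0 (_ : _ - _ = (q i - t) ^+ 2 * (q i + 2 * t)); last by ring.
  by rewrite mulr_ge0 ?sqr_ge0// addr_ge0// mulr_ge0.
by lra.
Qed.

Lemma size_box L : (size (box L) <= (2 * L).+1 * (h L).+1)%N.
Proof.
by rewrite size_filter (leq_trans (count_size _ _))// size_allpairs !size_map !size_iota.
Qed.

Lemma comb_heat_le_trans_prob k x w : vertex w -> comb_heat w k x <= trans_prob k x w.
Proof. by move=> vw; rewrite trans_probE// ler_peMl ?comb_heat_ge0// ler1n deg_gt0. Qed.

Variable C : nat.
Hypothesis vol_doubling : forall j, (tooth_size j.+1 <= C * tooth_size j)%N.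
Hypothesis C_gt0 : (0 < C)%N.

(** With [N] a bound on the number of vertices of the box of radius [16 * 2 ^ i],
    confinement gives mass at least one quarter to the box for the walk from [x].
    The kernels from [y] and [z] differ there from the kernel from [x] by at most
    [t = 1 / (32 N)], as their distance [D] is small compared with [2 ^ i].  The sum
    of the cubes of the kernel from [x] lowered by [t] is then of order
    [1 / N ^ 2] by the power mean inequality. *)
Lemma collision_lower i D L k x y z :
  vertex x -> vertex y -> vertex z -> parity y = parity x -> parity z = parity x ->
  linked D x y -> linked D x z -> (`|x.1| <= 2 ^ i)%N ->
  (forall n, (2 ^ i <= n)%N -> (16 * h n <= n)%N) ->
  64 * (32 * 36 * C%:R ^+ 4) ^+ 2 * D%:R <= 2 ^+ i :> R ->
  (2 * (4 ^ i * tooth_size i) <= k)%N -> (2 * k <= 16 * 4 ^ i * tooth_size i.+2)%N ->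
  (16 * 2 ^ i <= L)%N ->
  (32 * (32 * 36 * C%:R ^+ 2) ^+ 2 * (4 ^+ i * (tooth_size i.+2)%:R ^+ 2))^-1
    <= collision L k x y z.
Proof.
move=> vx vy vz yx zx xy xz xi hs iD ki k4 iL.
have [p pE] : {p | p = (2 ^ i)%N} by exists (2 ^ i)%N.
rewrite -pE in xi hs iL; have [r rE] : {r | r = (4 * p)%N} by exists (4 * p)%N.
have r4E : (4 * r = 2 ^ i.+4)%N by rewrite rE pE !expnS !mulnA.
have r0 : (0 < r)%N by rewrite rE pE muln_gt0 expn_gt0.
have [a aE] : {a | a = tooth_size i.+2} by exists (tooth_size i.+2).
rewrite -aE in k4 *.
have pi0 : 0 < 2 ^+ i :> R by rewrite exprn_gt0.
have p4E : 4 ^+ i = 2 ^+ i * 2 ^+ i :> R by rewrite exprn4.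
have a0 : 0 < a%:R :> R by rewrite ltr0n aE.
have b0 : 0 < (tooth_size i)%:R :> R by rewrite ltr0n.
have C0 : 0 < C%:R :> R by rewrite ltr0n.
have ab : a%:R <= C%:R ^+ 2 * (tooth_size i)%:R :> R.
  rewrite -natrX -natrM ler_nat aE; apply: leq_trans (vol_doubling _) _.
  by rewrite -mulnn -mulnA leq_pmul2l.
pose t : R := (32 * 36 * 2 ^+ i * C%:R ^+ 2 * a%:R)^-1.
have t0 : 0 < t by rewrite invr_gt0 !mulr_gt0// exprn_gt0.
have hr : (16 * h (4 * r) <= 4 * r)%N by apply: hs; rewrite rE mulnA leq_pmull.
have hi : (h (2 ^ i)%N <= 2 ^ i)%N by rewrite -pE; have := hs _ (leqnn p); clear; lia.
(* [N = 36 * 2 ^ i * C ^ 2 * a] bounds the size of the box of radius [4 * r]. *)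
have sz : (size (box (4 * r)))%:R * t <= 1 / 32.
  have : (size (box (4 * r)))%:R <= 36 * 2 ^+ i * C%:R ^+ 2 * a%:R :> R.
    have vC : (tooth_size i.+4 <= C ^ 2 * a)%N.
      by rewrite aE; apply: leq_trans (vol_doubling _) _; rewrite -mulnn -mulnA leq_pmul2l.
    rewrite -!natrX -!natrM ler_nat -pE; apply: leq_trans (size_box _) _.
    rewrite {1 2}r4E -/(tooth_size _) -r4E -[(_ * a)%N]mulnA; apply: leq_mul vC.
    by clear -rE r0; lia.
  move=> szN; apply: (@le_trans _ _ (36 * 2 ^+ i * C%:R ^+ 2 * a%:R * t)).
    by rewrite ler_wpM2r// ltW.
  rewrite le_eqVlt; apply/orP; left; apply/eqP; rewrite /t; field.
  by rewrite !gt_eqF.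
have close v w : vertex v -> parity v = parity x -> linked D x v -> w \in box (4 * r) ->
    comb_heat w k x - t <= comb_heat w k v.
  move=> vv pv xv; rewrite mem_box// => /andP[vw wr].
  have wi : w.2 <= (2 ^ i)%N%:Z.
    by move: vw => /andP[_ wh]; apply: le_trans wh _; rewrite lez_nat -pE; have := h_mono wr;
      clear -hr rE; lia.
  suff dt : comb_heat w k x - comb_heat w k v <= t by lra.
  case: (@comb_heat_diff R h w k x v (esym pv)) => ->; first exact: ltW.
  set d := (X in X <= _).
  have : (4 ^ i * tooth_size i)%:R * d ^+ 2 <= (2 * D)%:R * (32 / (2 ^+ i * (tooth_size i)%:R)).
    apply: le_trans (comb_heat2_diff R h_mono vw vx ki xv) _.
    by rewrite ler_wpM2l// comb_diag_level.
  rewrite natrM natrX p4E natrM => dD.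
  have d2 : d ^+ 2 <= t ^+ 2.
    have X0 : 0 < 2 ^+ i * 2 ^+ i * (tooth_size i)%:R :> R by rewrite !mulr_gt0.
    rewrite -(ler_pM2l X0); apply: le_trans dD _.
    pose K : R := 32 * 36 * C%:R ^+ 4; have K0 : 0 < K by rewrite !mulr_gt0 ?exprn_gt0.
    have st : (K * 2 ^+ i * (tooth_size i)%:R)^-1 <= t.
      rewrite lef_pV2 ?posrE; [|by rewrite !mulr_gt0 ?exprn_gt0..].
      rewrite (_ : K * _ * _ = 32 * 36 * 2 ^+ i * C%:R ^+ 2 * (C%:R ^+ 2 * (tooth_size i)%:R)).
        by rewrite ler_pM2l// !mulr_gt0 ?exprn_gt0.
      by rewrite /K; ring.
    have s0 : 0 < (K * 2 ^+ i * (tooth_size i)%:R)^-1 by rewrite invr_gt0 !mulr_gt0.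
    apply: (@le_trans _ _ (2 ^+ i * 2 ^+ i * (tooth_size i)%:R * (K * 2 ^+ i * (tooth_size
      i)%:R)^-1 ^+ 2)).
      rewrite -subr_ge0 [leRHS](_ : _ = (2 ^+ i - 64 * K ^+ 2 * D%:R) / (K ^+ 2 * 2 ^+ i *
        (tooth_size i)%:R)).
        by rewrite divr_ge0 ?subr_ge0// ltW// !mulr_gt0 ?exprn_gt0.
      by field; rewrite !gt_eqF.
    by rewrite ler_pM2l// ler_pXn2r// nnegrE ltW.
  apply: le_trans (ler_norm _) _; rewrite -(ler_pXn2r (ltn0Sn 1)) ?nnegrE ?(ltW t0)//.
  by rewrite real_normK ?num_real.
pose q w := Num.max 0 (comb_heat w k x - t).
have q0 w : 0 <= q w by rewrite le_max lexx.
have qsum : 1 / 32 <= \sum_(w <- box (4 * r)) q w.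
  have ci : 1 / 4 <= \sum_(w <- box (4 * r)) trans_prob k x w.
    apply: confine => //.
    - by move=> n rn; apply: hs; apply: leq_trans rn; rewrite rE leq_pmull.
    - by apply: leq_trans xi _; rewrite rE leq_pmull.
    - move: k4; rewrite (_ : (h r).+1 = a); last first.
        by rewrite aE /tooth_size !expnS mulnA -pE rE.
      by rewrite expn4 -pE rE expnMn.
  have gs : 1 / 16 <= \sum_(w <- box (4 * r)) comb_heat w k x.
    rewrite -(ler_pM2l (_ : 0 < 4))// mulr_sumr; apply: (@le_trans _ _ (1 / 4)); first by lra.
    apply: le_trans ci _; rewrite !big_seq; apply: ler_sum => w; rewrite mem_box// => /andP[vw _].
    by rewrite trans_probE// ler_wpM2r ?comb_heat_ge0// ler_nat deg_le4.
  apply: (@le_trans _ _ (\sum_(w <- box (4 * r)) (comb_heat w k x - t))); last first.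
    by apply: ler_sum => w _; rewrite le_max lexx orbT.
  by rewrite sumrB big_const_seq count_predT iter_addr addr0 -[t *+ _]mulr_natl; lra.
apply: (@le_trans _ _ (\sum_(w <- box (4 * r)) q w ^+ 3)).
  apply: le_trans (sum_cube_ge _ (ltW t0) q0).
  have t2 : 0 < t ^+ 2 by rewrite exprn_gt0.
  rewrite (_ : _^-1 = t ^+ 2 / 32); last first.
    by rewrite /t exprVn p4E -invfM; congr (_^-1); ring.
  have e3 : t ^+ 3 = t ^+ 2 * t by rewrite -exprSr.
  have := ler_wpM2l (ltW t2) qsum; have := ler_wpM2l (ltW t2) sz.
  by rewrite e3; lra.
apply: (@le_trans _ _ (\sum_(w <- box (4 * r)) trans_prob k x w * trans_prob k y w * trans_prob k
  z w)).
  rewrite !big_seq; apply: ler_sum => w wr.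
  have vw : vertex w by move: wr; rewrite mem_box// => /andP[].
  have p0 v : 0 <= trans_prob k v w by apply: trans_prob_ge0.
  have qp v : vertex v -> parity v = parity x -> linked D x v -> q w <= trans_prob k v w.
    by move=> vv pv xv; rewrite ge_max p0 (le_trans (close v w vv pv xv wr))//
      comb_heat_le_trans_prob.
  have xx : linked D x x by apply: linked_weak (linked_refl _ _).
  rewrite exprSr expr2; apply: ler_pM; rewrite ?mulr_ge0 ?q0 ?qp//.
  by apply: ler_pM; rewrite ?q0 ?qp.
apply: ler_sum_sub; rewrite ?uniq_box//; last by move=> w _; rewrite !mulr_ge0 ?trans_prob_ge0.
by move=> w; rewrite !mem_box// => /andP[-> /=] wr; apply: leq_trans wr _; clear -iL rE; lia.
Qed.
End Scales.

(** * Summation over dyadic blocks of times *)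

Section Blocks.
Variables (R : realFieldType) (a : nat -> nat) (C : nat) (F : nat -> R).
Hypothesis a_gt0 : forall j, (0 < a j)%N.

(** The time after which the bounds of level [j] apply. *)
Definition level_time (j : nat) : nat := (2 * (4 ^ j * a j))%N.

Lemma sum_block_le (m n : nat) b : (forall k, (m <= k < n)%N -> F k <= b) -> 0 <= b ->
  \sum_(m <= k < n) F k <= n%:R * b.
Proof.
move=> Fb b0; apply: (@le_trans _ _ (\sum_(m <= k < n) b)).
  by rewrite !big_nat; apply: ler_sum => k /Fb.
by rewrite sumr_const_nat -[b *+ _]mulr_natl ler_wpM2r// ler_nat leq_subr.
Qed.

(** Between two consecutive level times there are at most [8 * 4 ^ j * C * a j]
    times, each contributing at most [128 ^ 2 / (4 ^ j * a j ^ 2)]. *)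
Lemma sum_upper_long j0 J : (forall j, (a j <= a j.+1)%N) ->
  (forall j, (a j.+1 <= C * a j)%N) ->
  (forall j k, (j0 <= j)%N -> (level_time j <= k < level_time j.+1)%N ->
     F k <= 128 ^+ 2 / (4 ^+ j * (a j)%:R ^+ 2)) ->
  (j0 <= J)%N ->
  \sum_(0 <= k < level_time J) F k <= \sum_(0 <= k < level_time j0) F k +
    8 * 128 ^+ 2 * C%:R * \sum_(j0 <= j < J) (a j)%:R^-1.
Proof.
move=> amono adbl Fb; elim: J => [|J IH].
  by rewrite leqn0 => /eqP ->; rewrite (@big_geq _ _ _ 0 0)// mulr0 addr0.
rewrite leq_eqVlt => /predU1P[<-|]; first by rewrite (@big_geq _ _ _ j0 j0)// mulr0 addr0.
rewrite ltnS => jJ; rewrite (big_nat_recr J)//= mulrDr addrA.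
have sJ : (level_time J <= level_time J.+1)%N.
  by rewrite /level_time leq_pmul2l// leq_mul// leq_exp2l.
rewrite (big_cat_nat (n := level_time J))//=; apply: lerD (IH jJ) _.
have A0 : (a J)%:R != 0 :> R by rewrite pnatr_eq0 -lt0n.
have P0 : 4 ^+ J != 0 :> R by rewrite expf_neq0// pnatr_eq0.
have B0 : 0 <= 128 ^+ 2 / (4 ^+ J * (a J)%:R ^+ 2) :> R.
  by rewrite divr_ge0// ?mulr_ge0 ?exprn_ge0.
apply: le_trans (sum_block_le (Fb J ^~ jJ) B0) _.
apply: (@le_trans _ _ ((2 * (4 ^+ J.+1 * (C%:R * (a J)%:R))) *
   (128 ^+ 2 / (4 ^+ J * (a J)%:R ^+ 2)))).
  rewrite ler_wpM2r// /level_time !natrM natrX ler_wpM2l// ler_wpM2l ?exprn_ge0//.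
  by rewrite -natrM ler_nat.
rewrite le_eqVlt; apply/orP; left; apply/eqP; rewrite exprS.
move: (4 ^+ J) (a J)%:R (128 ^+ 2) P0 A0 => p x y p0 x0.
by field; rewrite p0 x0.
Qed.

(** Each dyadic block of times contributes at most a constant. *)
Lemma sum_upper_short I : (forall k, F k <= 1) ->
  (forall i k, (2 * 4 ^ i <= k)%N -> F k <= 64 ^+ 2 / 4 ^+ i) ->
  \sum_(0 <= k < 2 * 4 ^ I) F k <= 2 + 8 * 64 ^+ 2 * I%:R.
Proof.
move=> F1 Fb; elim: I => [|I IH].
  rewrite mulr0 addr0; apply: le_trans (sum_block_le (b := 1) _ _) _ => //.
  by rewrite mulr1 expn0 muln1.
have sI : (2 * 4 ^ I <= 2 * 4 ^ I.+1)%N by rewrite leq_pmul2l// leq_exp2l.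
rewrite (big_cat_nat (n := (2 * 4 ^ I)%N))//= -[I.+1%:R]natr1 mulrDr addrA mulr1.
apply: lerD IH _; have P0 : 4 ^+ I != 0 :> R by rewrite expf_neq0// pnatr_eq0.
have B0 : 0 <= 64 ^+ 2 / 4 ^+ I :> R by rewrite divr_ge0// ?exprn_ge0.
apply: le_trans (sum_block_le _ B0) _; first by move=> k /andP[/Fb].
rewrite natrM natrX exprS le_eqVlt; apply/orP; left; apply/eqP.
by move: (4 ^+ I) (64 ^+ 2) P0 => p y p0; field.
Qed.

(** The blocks of length [4 ^ (i + 1) * a (i + 2)] starting at their own length are
    disjoint. *)
Lemma sum_lower c i0 I : (forall k, 0 <= F k) -> 0 <= c ->
  (forall j, (a j <= a j.+1)%N) ->
  (forall i k, (i0 <= i < I)%N -> (4 ^ i.+1 * a i.+2 <= k < 2 * (4 ^ i.+1 * a i.+2))%N ->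
    c / (4 ^+ i * (a i.+2)%:R ^+ 2) <= F k) ->
  (i0 <= I)%N ->
  4 * c * \sum_(i0 <= i < I) (a i.+2)%:R^-1 <= \sum_(0 <= k < 4 ^ I.+1 * a I.+2) F k.
Proof.
move=> F0 c0 amono; elim: I => [|I IH] Fb.
  by rewrite leqn0 => /eqP ->; rewrite big_geq// mulr0 sumr_ge0.
rewrite leq_eqVlt => /predU1P[<-|]; first by rewrite big_geq// mulr0 sumr_ge0.
rewrite ltnS => iI; rewrite big_nat_recr//= mulrDr.
have {}IH := IH (fun i k ik =>
  Fb i k (andb_true_intro (conj (proj1 (andP ik)) (leqW (proj2 (andP ik)))))).
have sI : (2 * (4 ^ I.+1 * a I.+2) <= 4 ^ I.+2 * a I.+3)%N.
  by rewrite [(4 ^ I.+2)%N]expnS mulnA leq_mul// leq_mul2r// orbT.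
have s1 : (4 ^ I.+1 * a I.+2 <= 2 * (4 ^ I.+1 * a I.+2))%N by rewrite leq_pmull.
rewrite (big_cat_nat (leq0n _) (leq_trans s1 sI)) /=.
apply: lerD (IH iI) _; rewrite (big_cat_nat s1 sI) /=.
rewrite -[leLHS]addr0; apply: lerD; last by rewrite sumr_ge0.
have A0 : (a I.+2)%:R != 0 :> R by rewrite pnatr_eq0 -lt0n.
have P0 : 4 ^+ I != 0 :> R by rewrite expf_neq0// pnatr_eq0.
apply: (@le_trans _ _ (\sum_(4 ^ I.+1 * a I.+2 <= k < 2 * (4 ^ I.+1 * a I.+2))
    c / (4 ^+ I * (a I.+2)%:R ^+ 2))); last first.
  by rewrite [leLHS]big_nat [leRHS]big_nat; apply: ler_sum => k; apply: Fb; rewrite iI /=.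
rewrite sumr_const_nat mul2n -addnn addnK -[_ *+ (_ * _)]mulr_natl natrM natrX exprS.
rewrite le_eqVlt; apply/orP; left; apply/eqP.
by move: (4 ^+ I) (a I.+2)%:R P0 A0 => p x p0 x0; field; rewrite p0 x0.
Qed.
End Blocks.

(** Each dyadic block of the harmonic series contributes at least one half. *)
Lemma harmonic_dyadic (R : realFieldType) (a : nat -> nat) q :
  (forall j, (0 < a j <= j.+1)%N) ->
  q%:R <= 2 * \sum_(0 <= j < 2 ^ q) (a j)%:R^-1 :> R.
Proof.
move=> aj; elim: q => [|q IH].
  by rewrite mulr_ge0// sumr_ge0// => j _; rewrite invr_ge0.
have pq : (2 ^ q.+1 = 2 ^ q + 2 ^ q)%N by rewrite expnS mul2n addnn.
rewrite (big_cat_nat (n := (2 ^ q)%N)) ?pq ?leq_addr//= -[q.+1%:R]natr1 mulrDr.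
apply: lerD IH _; have P0 : 0 < 2 ^+ q :> R by rewrite exprn_gt0.
apply: (@le_trans _ _ (2 * \sum_(2 ^ q <= j < 2 ^ q + 2 ^ q) (2 * 2 ^+ q)^-1)).
  rewrite sumr_const_nat addnK -[_ *+ (2 ^ q)]mulr_natl natrX le_eqVlt; apply/orP; left.
  by apply/eqP; field; rewrite gt_eqF.
rewrite ler_pM2l// [leLHS]big_nat [leRHS]big_nat; apply: ler_sum => j /andP[_ jq].
have /andP[a0 aj1] := aj j.
rewrite lef_pV2 ?posrE ?ltr0n ?mulr_gt0// -natrX -natrM ler_nat mul2n -addnn.
exact: leq_trans aj1 jq.
Qed.

(** * Three independent walks *)

Section Triple.
Variables (R : realFieldType) (h : nat -> nat).
Hypothesis h_mono : {homo h : m n / (m <= n)%N}.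
Implicit Types u v w x y z : int * int.
Local Notation vertex := (vertex h).
Local Notation adj := (adj h).
Local Notation box := (box h).
Local Notation linked := (linked h).
Local Notation transition := (@transition R h).
Local Notation trans_prob := (@trans_prob R h).
Local Notation collision := (@collision R h).
Local Notation tooth_size := (tooth_size h).

(** The transition operator of three independent walks. *)
Definition transition3 (f : int * int -> int * int -> int * int -> R) x y z : R :=
  transition (fun x' => transition (fun y' => transition (f x' y') z) y) x.

Lemma transition3_le f g x y z :
  (forall x' y' z', adj x x' -> adj y y' -> adj z z' -> f x' y' z' <= g x' y' z') ->
  transition3 f x y z <= transition3 g x y z.
Proof.
move=> fg; apply: transition_le => x' xx; apply: transition_le => y' yy;
  apply: transition_le => z' zz.
exact: fg.
Qed.

Lemma eq_transition3 f g x y z :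
  (forall x' y' z', adj x x' -> adj y y' -> adj z z' -> f x' y' z' = g x' y' z') ->
  transition3 f x y z = transition3 g x y z.
Proof.
by move=> fg; apply/eqP; rewrite eq_le !transition3_le// => x' y' z' xx yy zz; rewrite fg.
Qed.

Lemma transition3_cst k x y z : vertex x -> vertex y -> vertex z ->
  transition3 (fun _ _ _ => k) x y z = k.
Proof.
move=> vx vy vz; rewrite /transition3 -[RHS](transition_cst k vx).
apply: eq_transition => x' _; rewrite -[RHS](transition_cst k vy).
by apply: eq_transition => y' _; rewrite transition_cst.
Qed.

Lemma transition3D f g x y z : transition3 (fun x y z => f x y z + g x y z) x y z =
  transition3 f x y z + transition3 g x y z.
Proof.
rewrite /transition3 -transitionD; apply: eq_transition => x' _; rewrite -transitionD.
by apply: eq_transition => y' _; rewrite -transitionD.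
Qed.

Lemma transition3Z k f x y z :
  transition3 (fun x y z => k * f x y z) x y z = k * transition3 f x y z.
Proof.
rewrite /transition3 -transitionZ; apply: eq_transition => x' _; rewrite -transitionZ.
by apply: eq_transition => y' _; rewrite -transitionZ.
Qed.

Lemma transition3_sum (I : Type) (s : seq I) F x y z :
  transition3 (fun x y z => \sum_(i <- s) F i x y z) x y z = \sum_(i <- s) transition3 (F i) x y z.
Proof.
rewrite /transition3 -transition_sum; apply: eq_transition => x' _; rewrite -transition_sum.
by apply: eq_transition => y' _; rewrite -transition_sum.
Qed.

Lemma transition3_ge0 f x y z : (forall x y z, 0 <= f x y z) -> 0 <= transition3 f x y z.
Proof. by move=> f0; do !apply: transition_ge0 => ?. Qed.

Definition meet x y z : bool := (x == y) && (y == z).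

Lemma collision0 L x y z : vertex x -> (`|x.1| <= L)%N -> collision L 0 x y z = (meet x y z)%:R.
Proof.
move=> vx xL; rewrite /collision (bigD1_seq x) ?uniq_box ?mem_box ?vx//= big1 ?addr0.
  rewrite /trans_prob /= eqxx mul1r -natrM mulnb /meet.
  by case: eqVneq => [->|]; rewrite ?eqxx //= eq_sym.
by move=> w /negPf wx; rewrite /trans_prob /= eq_sym wx !mul0r.
Qed.

(** Each term is a product of functions of the three coordinates, on which
    [transition3] acts factor by factor. *)
Lemma collisionS L k x y z : collision L k.+1 x y z = transition3 (collision L k) x y z.
Proof.
rewrite /collision transition3_sum; apply: eq_bigr => w _.
have pS v : trans_prob k.+1 v w = transition (fun v' => trans_prob k v' w) v by [].
transitivity (transition (fun x' => trans_prob k.+1 y w * trans_prob k.+1 z w * trans_prob k x'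
  w) x).
  by rewrite transitionZ -pS; ring.
apply: eq_transition => x' _.
transitivity (transition (fun y' => trans_prob k x' w * trans_prob k.+1 z w * trans_prob k y' w) y).
  by rewrite transitionZ -pS; ring.
by apply: eq_transition => y' _; rewrite transitionZ -pS; ring.
Qed.
End Triple.

(** * Expected meetings and the probability of no meeting *)

Section Meetings.
Variables (R : archiRealFieldType) (h : nat -> nat).
Hypothesis h_mono : {homo h : m n / (m <= n)%N}.
Implicit Types u v w x y z : int * int.
Local Notation vertex := (vertex h).
Local Notation adj := (adj h).
Local Notation box := (box h).
Local Notation linked := (linked h).
Local Notation transition := (@transition R h).
Local Notation transition3 := (@transition3 R h).
Local Notation trans_prob := (@trans_prob R h).
Local Notation collision := (@collision R h).
Local Notation tooth_size := (tooth_size h).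

(** The expected number of meetings at times [1], ..., [n]. *)
Fixpoint green n x y z : R :=
  if n is m.+1 then transition3 (fun x y z => (meet x y z)%:R + green m x y z) x y z else 0.

Definition transition_miss (f : int * int -> int * int -> int * int -> R) x y z : R :=
  transition3 (fun x y z => (~~ meet x y z)%:R * f x y z) x y z.

(** The probability of no meeting at times [1], ..., [n]. *)
Definition miss n : int * int -> int * int -> int * int -> R :=
  iter n transition_miss (fun _ _ _ => 1).

(** Decomposition at the first meeting: from then on, the expected number of
    meetings, including this one, is at most [M].  The recursion replaces the
    Markov property at the first meeting time. *)
Lemma green_miss L N M n x y z : vertex x -> vertex y -> vertex z ->
  (forall w m, vertex w -> (`|w.1| <= L)%N -> (m <= N)%N -> 1 + green m w w w <= M) ->
  (n <= N)%N -> (`|x.1| + n <= L)%N ->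
  green n x y z <= M * (1 - miss n x y z).
Proof.
move=> + + + GM; have M0 : 0 <= M.
  by apply: le_trans (GM (0, 0) 0%N _ _ _); rewrite //= addr0.
elim: n x y z => [|n IH] x y z vx vy vz nN xL /=; first by rewrite subrr mulr0.
have := transition3D h (fun _ _ _ => M)
  (fun x y z => - M * ((~~ meet x y z)%:R * miss n x y z)) x y z.
rewrite transition3_cst// transition3Z => e.
rewrite [leRHS](_ : _ = M + - M * transition_miss (miss n) x y z); last by ring.
rewrite -e; apply: transition3_le => x' y' z' xx yy zz.
have [_ vx'] := adj_vertex xx; have [_ vy'] := adj_vertex yy; have [_ vz'] := adj_vertex zz.
have x'L : (`|x'.1| + n <= L)%N by have := adj_dist xx; clear -xL; lia.
case: (boolP (meet x' y' z')) => [|_] /=.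
  rewrite /meet => /andP[/eqP <- /eqP <-]; rewrite mul0r mulr0 addr0.
  by apply: GM; rewrite ?(leq_trans (leq_addr n _) x'L)// ltnW.
by rewrite add0r mul1r; apply: le_trans (IH _ _ _ vx' vy' vz' (ltnW nN) x'L) _; lra.
Qed.

Lemma green_collision L n x y z : vertex x -> (`|x.1| + n <= L)%N ->
  green n x y z = \sum_(0 <= k < n) collision L k.+1 x y z.
Proof.
elim: n x y z => [|n IH] x y z vx xL; first by rewrite big_geq.
under eq_bigr do rewrite collisionS.
rewrite -transition3_sum -[LHS]/(transition3 (fun x y z => (meet x y z)%:R + green n x y z) x y z).
apply: eq_transition3 => x' y' z' xx _ _; have [_ vx'] := adj_vertex xx.
have x'L : (`|x'.1| + n <= L)%N by have := adj_dist xx; clear -xL; lia.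
rewrite IH// big_nat_recl// collision0//; exact: leq_trans (leq_addr _ _) x'L.
Qed.

Lemma linked_vertices L x y : vertex x -> vertex y -> (`|x.1| <= L)%N -> (`|y.1| <= L)%N ->
  linked (2 * (h L + L)) x y.
Proof.
have base v : vertex v -> (`|v.1| <= L)%N -> linked (h L + L) (0, 0) v.
  case: v => a b vv aL; have /= ha := h_mono aL; rewrite addnC.
  have [n bE] : exists n : nat, b = n%:Z by exists `|b|%N; move: vv; rewrite /vertex /=; lia.
  have nh : (n <= h `|a|)%N by move: vv; rewrite bE /vertex /=; lia.
  apply: linked_trans (_ : linked _ _ (a, 0)) _; last first.
    apply: linked_weak (leq_trans nh ha) _; rewrite bE; exact: (@linked_up h a 0 n).
  apply: (linked_weak (_ : `|a| <= _)%N); first exact: aL.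
  case: (leP 0 a) => a0.
    by have := linked_right h 0 `|a|; rewrite add0r gez0_abs.
  apply: linked_sym; have := linked_right h a `|a|.
  by rewrite (_ : a + `|a|%N%:Z = 0)//; lia.
move=> vx vy xL yL; rewrite mul2n -addnn.
exact: linked_trans (linked_sym (base x vx xL)) (base y vy yL).
Qed.

(** Three independent walks can only meet if their starting points have equal
    parity.  The bound [L] makes the set of such triples finite. *)
Definition good L x y z : Prop :=
  [/\ vertex x /\ (`|x.1| <= L)%N, vertex y /\ (`|y.1| <= L)%N, vertex z /\ (`|z.1| <= L)%N
   & parity y = parity x /\ parity z = parity x].

Lemma good_step L x y z x' y' z' : good L x y z -> adj x x' -> adj y y' -> adj z z' ->
  good L.+1 x' y' z'.
Proof.
move=> [[vx xL] [vy yL] [vz zL] [yx zx]] xx yy zz; split.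
- by split; [case: (adj_vertex xx)|have := adj_dist xx; clear -xL; lia].
- by split; [case: (adj_vertex yy)|have := adj_dist yy; clear -yL; lia].
- by split; [case: (adj_vertex zz)|have := adj_dist zz; clear -zL; lia].
- by rewrite (adj_parity xx) (adj_parity yy) (adj_parity zz) yx zx.
Qed.

Lemma miss_iter_le d n L m x y z : 0 <= d ->
  (forall x y z, good (L + n) x y z -> miss m x y z <= d) -> good L x y z ->
  miss (n + m) x y z <= d * miss n x y z.
Proof.
move=> d0; elim: n L x y z => [|n IH] L x y z md gx.
  by rewrite mulr1; apply: md; rewrite addn0.
rewrite addSn /= -/(miss _) /transition_miss -transition3Z;
  apply: transition3_le => x' y' z' xx yy zz.
rewrite mulrCA ler_wpM2l//; apply: (IH L.+1); last exact: good_step xx yy zz.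
by move=> x1 y1 z1; rewrite addSnnS; apply: md.
Qed.

(** After [n] steps the walks are still in a bounded region, from which the same
    bound applies again. *)
Lemma miss_geometric d : 0 <= d ->
  (forall L, exists n, forall x y z, good L x y z -> miss n x y z <= d) ->
  forall m L, exists n, forall x y z, good L x y z -> miss n x y z <= d ^+ m.
Proof.
move=> d0 dm; elim=> [|m IH] L.
  by exists 0%N => x y z _.
have [n1 n1P] := dm L; have [n2 n2P] := IH (L + n1)%N.
exists (n1 + n2)%N => x y z gx.
apply: le_trans (miss_iter_le (exprn_ge0 m d0) n2P gx) _.
by rewrite exprSr ler_wpM2l ?exprn_ge0 ?n1P.
Qed.

Variable C : nat.
Hypothesis vol_doubling : forall j, (tooth_size j.+1 <= C * tooth_size j)%N.
Hypothesis C_gt0 : (0 < C)%N.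

Let sizeS j : (tooth_size j <= tooth_size j.+1)%N. Proof. by apply: tooth_size_mono. Qed.
Let size_gt0 j : (0 < tooth_size j)%N. Proof. by []. Qed.

(** The height condition lets the bounds of level [j] apply to every vertex that
    is reachable before the next level time, as this time is at most
    [2 * 8 ^ (j + 1)]. *)
Lemma collision_summable j0 (b : R) :
  (forall j, (j0 <= j)%N -> (h (2 ^ (3 * j + 6)) <= 2 ^ j)%N) ->
  (forall J, \sum_(0 <= j < J) (tooth_size j)%:R^-1 <= b) ->
  exists b', forall n, \sum_(0 <= k < n) collision k k (0, 0) (0, 0) (0, 0) <= b'.
Proof.
move=> hj bs; pose F k := collision k k (0, 0) (0, 0) (0, 0).
exists (\sum_(0 <= k < level_time tooth_size j0) F k + 8 * 128 ^+ 2 * C%:R * b) => n.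
have F0 k : 0 <= F k by apply: collision_ge0.
(* Any level whose time exceeds [n] would do. *)
pose J := (n + j0)%N.
have nJ : (n <= level_time tooth_size J)%N.
  apply: leq_trans (leq_addr j0 n) _; rewrite -/J /level_time.
  apply: leq_trans (ltnW (ltn_expl J (_ : 1 < 4)%N)) _ => //.
  by rewrite mulnCA leq_pmulr// muln_gt0.
apply: (@le_trans _ _ (\sum_(0 <= k < level_time tooth_size J) F k)).
  by rewrite [leRHS](big_cat_nat (leq0n n) nJ) /= lerDl sumr_ge0.
apply: le_trans (sum_upper_long (C := C) (j0 := j0) _ _ _ _ _) _ => //; last 2 first.
- by rewrite leq_addl.
- rewrite lerD2l ler_wpM2l ?mulr_ge0 ?exprn_ge0//; apply: le_trans (bs J).
  rewrite [leRHS](big_cat_nat (leq0n j0) (leq_addl n j0)) /= lerDr.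
  by apply: sumr_ge0 => i _; rewrite invr_ge0.
move=> j k jj /andP[jk kj].
have comb_heat : (h k <= 2 ^ j)%N.
  apply: leq_trans (hj _ jj); apply: h_mono; apply: ltnW; apply: leq_trans kj _.
  have vj : (tooth_size j.+1 <= 2 ^ j.+1)%N.
    apply: (@leq_trans (2 ^ j).+1); last by rewrite ltn_exp2l.
    by rewrite ltnS; apply: leq_trans (hj _ jj); apply: h_mono; rewrite leq_exp2l//; clear; lia.
  rewrite /level_time; apply: leq_trans (_ : 2 * (4 ^ j.+1 * 2 ^ j.+1) <= _)%N.
    by rewrite !leq_mul.
  by rewrite expn4 -expnM -expnD -expnS leq_exp2l//; clear; lia.
apply: collision_level => //.
by apply: leq_trans (hj _ jj); apply: h_mono; rewrite leq_exp2l//; clear; lia.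
Qed.

End Meetings.

(** * Teeth of logarithmic size *)

Lemma pow2_unbounded (R : archiRealFieldType) (x : R) : exists i, x <= 2 ^+ i.
Proof.
by exists (Num.bound x); apply/ltW/upper_nthrootP.
Qed.

Section LogTeeth.
Variables (R : archiRealFieldType) (h : nat -> nat).
Hypothesis h_mono : {homo h : m n / (m <= n)%N}.
Implicit Types u v w x y z : int * int.
Local Notation vertex := (vertex h).
Local Notation collision := (@collision R h).
Local Notation green := (@green R h).
Local Notation miss := (@miss R h).
Local Notation good := (good h).
Local Notation tooth_size := (tooth_size h).

Variable C : nat.
Hypothesis vol_doubling : forall j, (tooth_size j.+1 <= C * tooth_size j)%N.
Hypothesis C_gt0 : (0 < C)%N.
Hypothesis h_log : forall j, (h (2 ^ j)%N <= j)%N.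

Let sizeS j : (tooth_size j <= tooth_size j.+1)%N. Proof. by apply: tooth_size_mono. Qed.
Let size_gt0 j : (0 < tooth_size j)%N. Proof. by []. Qed.

Lemma log_small i n : (7 <= i)%N -> (2 ^ i <= n)%N -> (16 * h n <= n)%N.
Proof.
move=> i7 ni; have n0 : (0 < n)%N by apply: leq_trans ni; rewrite expn_gt0.
have /andP[mn nm] := trunc_log_bounds (isT : (1 < 2)%N) n0.
have im : (i <= trunc_log 2 n)%N.
  by rewrite -ltnS -(ltn_exp2l _ _ (ltnSn 1)) (leq_ltn_trans ni nm).
move: (trunc_log 2 n) mn nm im => m mn nm im.
apply: leq_trans mn; apply: (@leq_trans (16 * m.+1)).
  by rewrite leq_mul2l /=; apply: leq_trans (h_mono (ltnW nm)) (h_log _).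
have : (7 <= m)%N := leq_trans i7 im.
elim: m {nm im} => // m IH; rewrite leq_eqVlt => /predU1P[<-//|/IH {}IH].
by rewrite [(2 ^ _)%N]expnS mul2n -addnn mulnS addnC leq_add// (leq_trans _ IH)// leq_pmulr.
Qed.

(** The time scale of level [2 ^ q].  A doubly exponential choice is natural: the
    expected number of meetings up to this time is at least of order [q], by
    divergence of the harmonic series, and teeth reached by then have height
    at most of order [2 ^ q]. *)
Definition horizon q : nat := (4 ^ (2 ^ q).+1 * tooth_size (2 ^ q).+2)%N.
Lemma tooth_size_le_pow j : (tooth_size j <= 2 ^ j)%N.
Proof. by apply: leq_trans (ltn_expl j (ltnSn 1)); rewrite ltnS h_log. Qed.

Lemma horizon_le q : (horizon q <= 2 ^ (3 * 2 ^ q + 4))%N.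
Proof.
rewrite (_ : 3 * 2 ^ q + 4 = (2 ^ q).+1 * 2 + (2 ^ q).+2)%N; last by lia.
by rewrite /horizon expnD expn4 -expnM leq_mul// tooth_size_le_pow.
Qed.

Definition tooth_sum q : R := \sum_(0 <= j < (2 ^ q).+2) (tooth_size j)%:R^-1.

Lemma tooth_sum_ge q : q%:R <= 2 * tooth_sum q.
Proof.
apply: le_trans (@harmonic_dyadic R tooth_size q _) _.
  by move=> j; apply: h_log.
rewrite ler_pM2l// /tooth_sum [leRHS](big_cat_nat (leq0n (2 ^ q))) ?leqW//= lerDl.
by apply: sumr_ge0 => j _; rewrite invr_ge0.
Qed.

(** The bounds of level [j] are available as soon as [2 ^ j] exceeds the height of
    all teeth within reach, which is the case for [j >= q + 4].  The earlier times
    contribute a constant per dyadic block, in total of order [q], which is no more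
    than the main term by [tooth_sum_ge]. *)
Lemma green_diag_le q L w m : (3 <= q)%N -> (L < horizon q)%N -> vertex w ->
  (`|w.1| <= L + horizon q)%N -> (m <= horizon q)%N ->
  1 + green m w w w <= 128 * 64 ^+ 2 * C%:R * (1 + tooth_sum q).
Proof.
move=> q3 Ln vw wL mn; set n := horizon q in Ln wL mn *.
(* Within [n] further steps the walks stay within [L']; from level [js] on, all
   teeth there are short. *)
pose L' := (4 * n)%N; pose js := (q + 4)%N.
have hL : (h L' <= 2 ^ js)%N.
  apply: (@leq_trans (3 * 2 ^ q + 6)).
    apply: leq_trans (h_log _); apply: h_mono; rewrite addnS addnS !expnS !mulnA.
    by rewrite leq_mul2l horizon_le orbT.
  rewrite expnD; have : (2 ^ 3 <= 2 ^ q)%N by rewrite leq_exp2l.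
  by move: (2 ^ q)%N; clear; lia.
have hjs : (h (2 ^ js)%N <= 2 ^ js)%N by apply: leq_trans (h_log _) (ltnW (ltn_expl _ _)).
have wL' : (`|w.1| + m <= L')%N by rewrite /L'; clear -Ln wL mn; lia.
pose F k := collision L' k w w w; have F0 k : 0 <= F k by apply: collision_ge0.
have g1 : green m w w w <= \sum_(0 <= k < level_time tooth_size (2 ^ q).+2) F k.
  rewrite (green_collision R h_mono w w vw wL') -[leLHS]add0r.
  have ms : (m < level_time tooth_size (2 ^ q).+2)%N.
    apply: leq_ltn_trans mn _; rewrite /n /horizon /level_time [(4 ^ (2 ^ q).+2)%N]expnS.
    have : (0 < 4 ^ (2 ^ q).+1 * tooth_size (2 ^ q).+2)%N by rewrite muln_gt0 expn_gt0.
    by rewrite -[(4 * _ * _)%N]mulnA; move: (4 ^ _ * _)%N; clear; lia.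
  rewrite [leRHS](big_cat_nat (leq0n m.+1) ms) /= -[leLHS]addr0 lerD ?sumr_ge0//.
  by rewrite [leRHS]big_nat_recl// lerD.
have g2 : \sum_(0 <= k < level_time tooth_size (2 ^ q).+2) F k <=
    \sum_(0 <= k < level_time tooth_size js) F k +
      8 * 128 ^+ 2 * C%:R * \sum_(js <= j < (2 ^ q).+2) (tooth_size j)%:R^-1.
  apply: sum_upper_long => //.
    move=> j k jj /andP[jk _]; apply: collision_level => //.
    - by apply: leq_trans (leq_addr _ _) wL'.
    - by apply: leq_trans hL _; rewrite leq_exp2l.
    - by apply: leq_trans (h_log _) (ltnW (ltn_expl _ _)).
  rewrite /js -[(2 ^ q).+2]addn2 (addnA q 2 2) leq_add2r.
  elim: (q) q3 => // k IH; rewrite leq_eqVlt => /predU1P[<-//|/IH {}IH].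
  by rewrite expnS; clear -IH; lia.
have g3 : \sum_(0 <= k < level_time tooth_size js) F k <= 2 + 8 * 64 ^+ 2 * (2 * js)%:R.
  apply: (@le_trans _ _ (\sum_(0 <= k < 2 * 4 ^ (2 * js)) F k)).
    have ss : (level_time tooth_size js <= 2 * 4 ^ (2 * js))%N.
      rewrite /level_time leq_mul2l /= mul2n -addnn expnD leq_mul2l.
      apply/orP; right; apply: leq_trans (tooth_size_le_pow js) _.
      by rewrite leq_exp2r// /js addnS.
    by rewrite [leRHS](big_cat_nat (leq0n _) ss) /= lerDl sumr_ge0.
  apply: sum_upper_short; first by move=> k; apply: collision_le1.
  by move=> i k ik; apply: collision_level_short.
have g4 : \sum_(js <= j < (2 ^ q).+2) (tooth_size j)%:R^-1 <= tooth_sum q.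
  have [jJ|Jj] := leqP js (2 ^ q).+2; last first.
    by rewrite big_geq ?(ltnW Jj)// sumr_ge0// => j _; rewrite invr_ge0.
  rewrite /tooth_sum [leRHS](big_cat_nat (leq0n js) jJ) /= lerDr.
  by apply: sumr_ge0 => j _; rewrite invr_ge0.
have C1 : 1 <= C%:R :> R by rewrite ler1n.
have qS := tooth_sum_ge q.
have K1 : 1 <= 64 ^+ 2 :> R by rewrite exprn_ege1// ler1n.
have E128 : 128 ^+ 2 = 4 * 64 ^+ 2 :> R by ring.
move: g1 g2 g3 g4; rewrite E128 natrM natrD.
move: (64 ^+ 2 : R) K1 => K K1 g1 g2 g3 g4.
have S0 : 0 <= tooth_sum q by apply: sumr_ge0 => j _; rewrite invr_ge0.
have KC : K <= K * C%:R by rewrite ler_peMr// (le_trans ler01).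
have KC0 : 0 <= K * C%:R by apply: le_trans KC; apply: le_trans K1.
have KCS : K * tooth_sum q <= K * C%:R * tooth_sum q by rewrite ler_wpM2r.
have K0 : 0 <= K by apply: le_trans K1.
have KqS := ler_wpM2l K0 qS; have g5 := ler_wpM2l KC0 g4.
by have := mulr_ge0 KC0 S0; lra.
Qed.

(** Levels [i >= i0] satisfy the hypotheses of [collision_lower].  The first
    [i0 + 2] terms of [tooth_sum] are given up, at most one each, and so is
    the possible meeting at time zero. *)
Lemma green_ge q L i0 x y z : good L x y z -> (7 <= i0)%N -> (L <= 2 ^ i0)%N ->
  64 * (32 * 36 * C%:R ^+ 4) ^+ 2 * (2 * (h L + L))%:R <= 2 ^+ i0 :> R ->
  (i0 <= 2 ^ q)%N ->
  4 * (32 * (32 * 36 * C%:R ^+ 2) ^+ 2)^-1 * (tooth_sum q - i0.+2%:R) - 1 <=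
  green (horizon q) x y z.
Proof.
move=> [[vx xL] [vy yL] [vz zL] [yx zx]] i7 Li iD iq.
set c := (32 * _)^-1; have c0 : 0 <= c by rewrite invr_ge0 mulr_ge0// sqr_ge0.
set n := horizon q; pose L' := (L + n + 16 * 2 ^ (2 ^ q))%N.
have xL' : (`|x.1| + n <= L')%N by rewrite /L' -addnA leq_add// leq_addr.
rewrite (green_collision R h_mono y z vx xL').
pose F k := collision L' k x y z; have F0 k : 0 <= F k by apply: collision_ge0.
have low : 4 * c * \sum_(i0 <= i < 2 ^ q) (tooth_size i.+2)%:R^-1 <= \sum_(0 <= k < n) F k.
  apply: sum_lower => // i k /andP[ii iI] /andP[ik ki].
  have hi : (7 <= i)%N := leq_trans i7 ii.
  have pi : (2 ^ i0 <= 2 ^ i)%N by rewrite leq_exp2l.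
  rewrite -invfM; apply: (@collision_lower _ _ h_mono C vol_doubling C_gt0 i (2 * (h L + L))) => //.
  - exact: linked_vertices.
  - exact: linked_vertices.
  - exact: leq_trans (leq_trans xL Li) pi.
  - by move=> m; apply: log_small.
  - by apply: le_trans iD _; rewrite -!natrX ler_nat.
  - apply: leq_trans ik; rewrite [(4 ^ i.+1)%N]expnS mulnA leq_mul//.
      by rewrite leq_mul2r orbT.
    exact: leq_trans (sizeS _) (sizeS _).
  - by move: ki; rewrite [(4 ^ i.+1)%N]expnS -!mulnA; move: (4 ^ i * _)%N; clear; lia.
  - apply: leq_trans (leq_addl _ _); rewrite leq_mul2l /= leq_exp2l//; exact: ltnW.
have s1 : tooth_sum q - i0.+2%:R <= \sum_(i0 <= i < 2 ^ q) (tooth_size i.+2)%:R^-1.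
  rewrite /tooth_sum lerBlDr (big_cat_nat (leq0n i0.+2) (_ : _ <= (2 ^ q).+2)%N)//= addrC.
  apply: lerD.
    rewrite -[i0.+2 in leLHS]addn2 -[(2 ^ q).+2]addn2 big_addn addnK.
    by under eq_bigr do rewrite addn2.
  rewrite -[leRHS]mulr1; apply: sum_block_le => // j _.
  by rewrite invf_le1 ?ltr0n// ler1n.
have s2 : \sum_(0 <= k < n) F k <= \sum_(0 <= k < n) F k.+1 + 1.
  have c1 : F 0%N <= 1.
    rewrite /F collision0 ?lern1 ?leq_b1//; exact: leq_trans (leq_addr _ _) xL'.
  apply: (@le_trans _ _ (\sum_(0 <= k < n.+1) F k)).
    by rewrite big_nat_recr//= lerDl.
  by rewrite big_nat_recl// addrC lerD2l.
have c40 : 0 <= 4 * c by rewrite mulr_ge0.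
by have := ler_wpM2l c40 s1; rewrite /F /= in low s2 *; lra.
Qed.

(** Both bounds on the expected number of meetings are proportional to
    [1 + tooth_sum q], up to constants not depending on the starting points once [q]
    is large; [green_miss] then bounds [miss] away from one. *)
Lemma miss_uniform : exists d : R, [/\ 0 <= d, d < 1 &
  forall L, exists n, forall x y z, good L x y z -> miss n x y z <= d].
Proof.
have C1 : 1 <= C%:R :> R by rewrite ler1n.
have k1 : 1 <= (32 * 36 * C%:R ^+ 2) ^+ 2 :> R.
  by apply/exprn_ege1/mulr_ege1; [apply: mulr_ege1; rewrite ler1n|apply: exprn_ege1].
set c := (32 * (32 * 36 * C%:R ^+ 2) ^+ 2)^-1 : R; set B := 128 * 64 ^+ 2 * C%:R : R.
have k0 : 0 < (32 * 36 * C%:R ^+ 2) ^+ 2 :> R by apply: lt_le_trans k1.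
have c0 : 0 < c by rewrite invr_gt0 pmulr_rgt0// ltr0n.
have B1 : 1 <= B.
  have K1 : 1 <= 64 ^+ 2 :> R by apply: exprn_ege1; rewrite ler1n.
  by apply: mulr_ege1 => //; apply: mulr_ege1 => //; rewrite ler1n.
have c1 : c <= 1 / 32.
  by rewrite mul1r lef_pV2 ?posrE ?ltr0n ?pmulr_rgt0 ?ltr0n// ler_peMr// ler0n.
have B0 : 0 < B by apply: lt_le_trans B1.
exists (1 - 2 * c / B); split.
- by rewrite subr_ge0 ler_pdivrMr//; lra.
- by rewrite ltrBlDr ltrDl divr_gt0// mulr_gt0.
move=> L; have [i1 i1P] := pow2_unbounded (64 * (32 * 36 * C%:R ^+ 4) ^+ 2 * (2 * (h L + L))%:R :
  R).
pose i0 := (7 + L + i1)%N.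
have [q1 q1P] := pow2_unbounded (c^-1).
(* With this [q], [2 * c * tooth_sum q] exceeds what [green_ge] gives up plus
   [2 * c]. *)
pose q := (2 ^ q1 + 4 * i0.+2 + 2)%N.
have qq : (q < 2 ^ q)%N by apply: ltn_expl.
have Lh : (L < horizon q)%N.
  apply: (@leq_trans q); first by rewrite /q /i0; clear; lia.
  apply: leq_trans (ltnW qq) _; rewrite /horizon -[leqLHS]muln1 leq_mul//.
  by rewrite expn4 -expnM leq_exp2l// mulSn muln2; clear -qq; lia.
exists (horizon q) => x y z gx.
have g1 := @green_ge q L i0 x y z gx.
have {g1} : 4 * c * (tooth_sum q - i0.+2%:R) - 1 <= green (horizon q) x y z.
  apply: g1.
  - by rewrite /i0 -addnA leq_addr.
  - by apply: leq_trans (ltnW (ltn_expl L (ltnSn 1))) _; rewrite leq_exp2l// /i0 addnAC leq_addl.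
  - by apply: le_trans i1P _; rewrite -!natrX ler_nat leq_exp2l// leq_addl.
  - by apply: leq_trans (ltnW qq); rewrite /q; clear; lia.
have [[vx xL] [vy yL] [vz zL] _] := gx => g1.
have := @green_miss R h (L + horizon q) (horizon q) (B * (1 + tooth_sum q)) (horizon q) x y z vx
  vy vz.
move=> /(_ _ (leqnn _)) gm.
have {gm} : green (horizon q) x y z <= B * (1 + tooth_sum q) * (1 - miss (horizon q) x y z).
  apply: gm; last by rewrite leq_add2r.
  by move=> w m vw wL mh; apply: (@green_diag_le q L) => //; rewrite /q; clear; lia.
have S1 : 2 ^+ q1 + 4 * i0.+2%:R + 2 <= 2 * tooth_sum q.
  by apply: le_trans (tooth_sum_ge q); rewrite /q !natrD natrM natrX.
move: (tooth_sum q) (miss _ x y z) (i0.+2%:R : R) (ler0n R i0.+2) S1 g1 => S p t t0 S1 g1 gm.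
have cS : 1 <= c * 2 ^+ q1 by rewrite -ler_pdivrMl// mulr1.
have P0 : 0 < 2 ^+ q1 :> R by rewrite exprn_gt0.
have S0 : 0 < 1 + S by lra.
have low : 2 * c * (1 + S) <= B * (1 + S) * (1 - p).
  apply: le_trans (le_trans g1 gm).
  by have := ler_wpM2l (ltW c0) S1; lra.
rewrite lerBrDl -lerBrDr ler_pdivrMr//.
rewrite -(ler_pM2r S0); apply: le_trans low _.
by rewrite le_eqVlt; apply/orP; left; apply/eqP; ring.
Qed.
End LogTeeth.

(** * From the transition operator to the probability space *)

Section Sieve.
Variables (R : archiRealFieldType) (h : nat -> nat).
Hypothesis h_mono : {homo h : m n / (m <= n)%N}.
Implicit Types u v w x y z : int * int.

(** The probability, starting from [x], [y], [z] at time [m], that the constraints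
    [A] hold at times [m + 1], ..., [m + n]. *)
Fixpoint sieve (A : nat -> int * int -> int * int -> int * int -> bool) n m x y z : R :=
  if n is n'.+1 then
    transition3 h (fun x y z => (A m.+1 x y z)%:R * sieve A n' m.+1 x y z) x y z
  else 1.

Lemma sieveS A n m x y z : sieve A n.+1 m x y z =
  transition3 h (fun x y z => (A m.+1 x y z)%:R * sieve A n m.+1 x y z) x y z.
Proof. by []. Qed.

Lemma sieve_ge0 A n m x y z : 0 <= sieve A n m x y z.
Proof.
elim: n m x y z => [//|n IH] m x y z; rewrite sieveS.
by apply: transition3_ge0 => *; rewrite mulr_ge0.
Qed.

Lemma sieve_meet N L n m x y z : (m + n.+1 = N)%N -> vertex h x -> (`|x.1| + n.+1 <= L)%N ->
  sieve (fun k x y z => (k == N) ==> meet x y z) n.+1 m x y z = collision R h L n.+1 x y z.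
Proof.
elim: n m x y z => [|n IH] m x y z mN vx xL.
  rewrite (collisionS R h L 0); apply: eq_transition3 => x' y' z' xx _ _.
  have [_ vx'] := adj_vertex xx.
  have -> : (m.+1 == N) = true by apply/eqP; rewrite -mN addn1.
  rewrite collision0//= ?mulr1//.
  by have := adj_dist xx; clear -xL; lia.
rewrite (collisionS R h L n.+1).
rewrite sieveS; apply: eq_transition3 => x' y' z' xx _ _; have [_ vx'] := adj_vertex xx.
have -> : (m.+1 == N) = false by apply/negbTE; clear -mN; lia.
rewrite /= mul1r; apply: IH => //; first by clear -mN; lia.
by have := adj_dist xx; clear -xL; lia.
Qed.

Lemma sieve_miss N n m x y z : (N <= m)%N ->
  sieve (fun k x y z => (N < k)%N ==> ~~ meet x y z) n m x y z = miss R h n x y z.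
Proof.
elim: n m x y z => [//|n IH] m x y z Nm; rewrite sieveS /miss iterS.
by apply: eq_transition3 => x' y' z' _ _ _; rewrite ltnS Nm IH// ltnW.
Qed.

(** Nothing is required up to time [N], and by then the walks have moved by
    at most [j]. *)
Lemma sieve_miss_le N e L n j m x y z : 0 <= e -> (m + j = N)%N ->
  (forall x y z, good h (L + j) x y z -> miss R h n x y z <= e) -> good h L x y z ->
  sieve (fun k x y z => (N < k)%N ==> ~~ meet x y z) (j + n) m x y z <= e.
Proof.
move=> e0; elim: j L m x y z => [|j IH] L m x y z mN me gx.
  by rewrite sieve_miss ?me// -?mN addn0.
have [[vx _] [vy _] [vz _] _] := gx.
rewrite -[leRHS](transition3_cst e vx vy vz) addSn sieveS;
  apply: transition3_le => x' y' z' xx yy zz.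
rewrite ltnNge (_ : (m < N)%N) /= ?mul1r; last by rewrite -mN addnS ltnS leq_addr.
apply: (IH L.+1); first by rewrite addSnnS.
  by move=> x1 y1 z1; rewrite addSnnS; apply: me.
exact: good_step gx xx yy zz.
Qed.
End Sieve.

Section Chains.
Context (R : realType) (d : measure_display) (T : measurableType d) (P : probability T R).
Variables (h : nat -> nat) (E : int * int -> int * int -> Prop).
Hypothesis stepE : forall u v : int * int, srw_step E u v = step R h u v.
Local Notation V := (int * int)%type.
Implicit Types (u v : V) (x y z : nat -> V).
Implicit Types (X Y Z : nat -> T -> V).
Local Notation o := ((0, 0) : V).

Definition hist X n (x : nat -> V) : set T := [set w | forall k, (k <= n)%N -> X k w = x k].

(** Countable unions and complements are the operations available in a generated
    sigma-algebra. *)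
Lemma histE X n x :
  hist X n x = ~` \bigcup_k (if (k <= n)%N then ~` (X k @^-1` [set x k]) else set0).
Proof.
apply/seteqP; split => w /= wH.
  by move=> [k _]; case: ifP => // kn; apply; exact: wH.
move=> k kn; apply: contrapT => Xk; apply: wH; exists k => //.
by rewrite kn.
Qed.

Lemma process_sigma_hist X n x : process_sigma X (hist X n x).
Proof.
have [s0 sC sU] := @smallest_sigma_algebra T setT [set B | exists n (A : set V), B = X n @^-1` A].
rewrite histE -setTD; apply: (sC); apply: (sU) => k; case: ifP => kn; last exact: s0.
by rewrite -setTD; apply: (sC); apply: sub_sigma_algebra; exists k, [set x k].
Qed.

Lemma measurable_hist X n x : (forall n (A : set V), measurable (X n @^-1` A)) ->
  measurable (hist X n x).
Proof.
move=> mX; rewrite histE; apply: measurableC; apply: bigcupT_measurable => k.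
by case: ifP => // _; apply: measurableC; apply: mX.
Qed.

(** There are countably many finite histories, and each one that ends with an
    illegal step has probability zero. *)
Lemma illegal_step_negligible X : simple_random_walk P E o X ->
  P.-negligible [set w | X 0%N w != o \/ exists n, ~~ adj h (X n w) (X n.+1 w)].
Proof.
move=> [mX X0 pX].
have n0 : P.-negligible [set w | X 0%N w != o].
  have m0 : measurable [set w | X 0%N w = o] by have := mX 0%N [set o].
  have e0 : [set w | X 0%N w != o] = ~` [set w | X 0%N w = o].
    by apply/seteqP; split => w /=; [move/eqP|move=> ?; apply/eqP].
  apply/(@negligibleP _ _ _ P); first by rewrite e0; apply: measurableC.
  have : P [set w | X 0%N w != o] = 0%E by rewrite e0 probability_setC// X0 subee.
  by [].
have n1 n : P.-negligible [set w | ~~ adj h (X n w) (X n.+1 w)].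
  pose F (i : nat) : set T := if (unpickle i : option (seq V)) is Some s then
      if adj h (nth o s n) (nth o s n.+1) then set0 else hist X n.+1 (nth o s)
    else set0.
  apply: (@negligibleS _ _ _ P (\bigcup_i F i)); last first.
    apply: negligible_bigcup => i; rewrite /F; case: unpickle => [s|]; last exact: negligible_set0.
    case: ifPn => na; first exact: negligible_set0.
    apply/(@negligibleP _ _ _ P); first exact: measurable_hist.
    have : P (hist X n.+1 (nth o s)) = 0%E.
      by rewrite /hist pX stepE /step (negbTE na) mul0r mule0.
    by [].
  move=> w /= na; pose s := mkseq (X ^~ w) n.+2.
  exists (pickle s); [exact: I|rewrite /F pickleK].
  rewrite !nth_mkseq ?ltnS// (negbTE na) => k kn /=.
  by rewrite nth_mkseq.
apply: (@negligibleS _ _ _ P ([set w | X 0%N w != o] `|`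
    \bigcup_n [set w | ~~ adj h (X n w) (X n.+1 w)])).
  by move=> w /= [?|[n nn]]; [left|right; exists n].
by apply: negligibleU => //; apply: negligible_bigcup.
Qed.

Variables X Y Z : nat -> T -> V.
Hypotheses (hX : simple_random_walk P E o X) (hY : simple_random_walk P E o Y)
  (hZ : simple_random_walk P E o Z) (hXYZ : independent3 P X Y Z).

Let mX : forall n (A : set V), measurable (X n @^-1` A). Proof. by case: hX. Qed.
Let mY : forall n (A : set V), measurable (Y n @^-1` A). Proof. by case: hY. Qed.
Let mZ : forall n (A : set V), measurable (Z n @^-1` A). Proof. by case: hZ. Qed.

Definition hist3 n x y z : set T := hist X n x `&` hist Y n y `&` hist Z n z.

Definition pr (A : set T) : R := fine (P A).

Lemma prE A : measurable A -> P A = (pr A)%:E.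
Proof. by move=> mA; rewrite fineK// fin_num_measure. Qed.

Lemma pr_ge0 A : 0 <= pr A.
Proof. by apply: fine_ge0. Qed.

Lemma le_pr A B : measurable A -> measurable B -> A `<=` B -> pr A <= pr B.
Proof.
by move=> mA mB AB; rewrite -lee_fin -!prE//; apply: le_measure => //; rewrite inE.
Qed.

Lemma prU A B : measurable A -> measurable B -> pr (A `|` B) <= pr A + pr B.
Proof.
move=> mA mB; rewrite -lee_fin EFinD -!prE//; last exact: measurableU.
exact: measureU2.
Qed.

Lemma pr0 : pr set0 = 0. Proof. by rewrite /pr measure0. Qed.

Lemma measurable_hist3 n x y z : measurable (hist3 n x y z).
Proof. by apply: measurableI; [apply: measurableI|]; apply: measurable_hist. Qed.

Lemma pr_hist3 n x y z : pr (hist3 n x y z) = pr (hist X n x) * pr (hist Y n y) * pr (hist Z n z).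
Proof.
rewrite /pr hXYZ; [|exact: process_sigma_hist..].
by rewrite !fineM// ?fin_numM// fin_num_measure//; apply: measurable_hist.
Qed.

Lemma pr_histS X' n x : simple_random_walk P E o X' ->
  pr (hist X' n.+1 x) = pr (hist X' n x) * step R h (x n) (x n.+1).
Proof.
move=> [mX' _ pX']; rewrite /pr /hist pX' fineM ?stepE// fin_num_measure//.
exact: measurable_hist.
Qed.

(** By independence, the joint law of the histories is that of a Markov chain with
    product transitions. *)
Lemma pr_hist3S n x y z : pr (hist3 n.+1 x y z) = pr (hist3 n x y z) *
  (step R h (x n) (x n.+1) * (step R h (y n) (y n.+1) * step R h (z n) (z n.+1))).
Proof. by rewrite !pr_hist3 !pr_histS//; ring. Qed.

Lemma pr_split (W : nat -> T -> V) (A : set T) k s :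
  (forall n (B : set V), measurable (W n @^-1` B)) ->
  measurable A -> (forall w, A w -> W k w \in s) ->
  pr A <= \sum_(v <- s) pr (A `&` [set w | W k w = v]).
Proof.
move=> mW; elim: s A => [|v s IH] A mA As.
  rewrite big_nil (_ : A = set0) ?pr0//; apply/seteqP; split => // w /As.
  by rewrite in_nil.
have mv v' : measurable [set w | W k w = v'] by have := mW k [set v'].
rewrite big_cons; apply: (@le_trans _ _
  (pr ((A `&` [set w | W k w = v]) `|` (A `\` [set w | W k w = v])))).
  rewrite le_pr//; last by rewrite setDE -setIUr setUv setIT.
  by apply: measurableU; [apply: measurableI|apply: measurableD].
apply: le_trans (prU _ _) _; [exact: measurableI|exact: measurableD|].
rewrite lerD2l; apply: le_trans (IH _ _ _) _; first exact: measurableD.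
  by move=> w [/As]; rewrite inE => /orP[/eqP//|].
apply: ler_sum => v' _; apply: le_pr.
- by apply: measurableI => //; exact: measurableD.
- exact: measurableI.
- by apply: setSI; exact: subDsetl.
Qed.

Lemma measurable_meet3 (A : V -> V -> V -> bool) k :
  measurable [set w | A (X k w) (Y k w) (Z k w)].
Proof.
pose F (i : nat) : set T := if (unpickle i : option (V * V)) is Some uv then
  X k @^-1` [set uv.1] `&` Y k @^-1` [set uv.2] `&` Z k @^-1` [set v | A uv.1 uv.2 v] else set0.
rewrite (_ : [set w | _] = \bigcup_i F i).
  apply: bigcupT_measurable => i; rewrite /F; case: unpickle => [[u v]|] //.
  by do 2?apply: measurableI.
apply/seteqP; split => w /=.
  by move=> Aw; exists (pickle (X k w, Y k w)); [exact: I|rewrite /F pickleK].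
by move=> [i _]; rewrite /F; case: unpickle => [[u v]|] //= [[-> ->]].
Qed.

Definition obey (A : nat -> V -> V -> V -> bool) m n : set T :=
  [set w | forall k, (m < k <= m + n)%N -> A k (X k w) (Y k w) (Z k w)].

Lemma measurable_obey A m n : measurable (obey A m n).
Proof.
rewrite (_ : obey A m n = \bigcap_k [set w | (m < k <= m + n)%N ==> A k (X k w) (Y k w) (Z k w)]).
  apply: bigcapT_measurable => k.
  exact: (measurable_meet3 (fun u v u' => (m < k <= m + n)%N ==> A k u v u') k).
apply/seteqP; split => w /= H k; first by move=> _; apply/implyP/H.
by apply/implyP/H.
Qed.

Definition extend x n v : nat -> V := fun k => if (k <= n)%N then x k else v.

Lemma extend_id x n v : extend x n v n = x n.
Proof. by rewrite /extend leqnn. Qed.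

Lemma extend_new x n v : extend x n v n.+1 = v.
Proof. by rewrite /extend ltnn. Qed.

Lemma hist_extend_id X' n x v : hist X' n (extend x n v) = hist X' n x.
Proof.
by apply/seteqP; split => w H k kn; have := H k kn; rewrite /extend kn.
Qed.

Lemma hist3_extend_id n x y z u v u' :
  hist3 n (extend x n u) (extend y n v) (extend z n u') = hist3 n x y z.
Proof. by rewrite /hist3 !hist_extend_id. Qed.

Lemma hist_extend X' n x v : hist X' n.+1 (extend x n v) =
  hist X' n x `&` [set w | X' n.+1 w = v].
Proof.
apply/seteqP; split => w /=.
  move=> H; split => [k kn|]; first by rewrite H ?leqW// /extend kn.
  by have := H n.+1 (leqnn _); rewrite /extend ltnn.
move=> [H Hv] k; rewrite leq_eqVlt /extend => /predU1P[->|]; first by rewrite ltnn.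
by rewrite ltnS => kn; rewrite kn H.
Qed.

Lemma illegal_null : exists N : set T, [/\ measurable N, pr N = 0 & forall w, ~ N w ->
  [/\ X 0%N w = o, Y 0%N w = o, Z 0%N w = o & forall n,
   [/\ adj h (X n w) (X n.+1 w), adj h (Y n w) (Y n.+1 w) & adj h (Z n w) (Z n.+1 w)]]].
Proof.
have := negligibleU (negligibleU (illegal_step_negligible hX) (illegal_step_negligible hY))
  (illegal_step_negligible hZ).
move=> [N [mN N0 sN]]; exists N; split=> //; first by rewrite /pr N0.
move=> w Nw.
have ok W : ([set w | W 0%N w != o \/ exists n, ~~ adj h (W n w) (W n.+1 w)] `<=` N) ->
    W 0%N w = o /\ forall n, adj h (W n w) (W n.+1 w).
  move=> WN; split; first by apply: contrapT => /eqP ?; apply/Nw/WN; left.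
  by move=> n; apply: contrapT => /negP ?; apply/Nw/WN; right; exists n.
have [X0 Xa] : X 0%N w = o /\ forall n, adj h (X n w) (X n.+1 w).
  by apply: ok => w' ?; apply: sN; left; left.
have [Y0 Ya] : Y 0%N w = o /\ forall n, adj h (Y n w) (Y n.+1 w).
  by apply: ok => w' ?; apply: sN; left; right.
have [Z0 Za] : Z 0%N w = o /\ forall n, adj h (Z n w) (Z n.+1 w).
  by apply: ok => w' ?; apply: sN; right.
by split.
Qed.

(** Outside [N] all steps are along edges, so the next positions are neighbours of
    the current ones.  The event is split accordingly into finitely many events with
    one more step of history; those violating the constraint are empty. *)
Lemma pr_obey_hist A N n m x y z : measurable N ->
  (forall w, ~ N w -> forall n,
   [/\ adj h (X n w) (X n.+1 w), adj h (Y n w) (Y n.+1 w) & adj h (Z n w) (Z n.+1 w)]) ->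
  pr ((hist3 m x y z `&` obey A m n) `\` N) <=
  pr (hist3 m x y z) * sieve R h A n m (x m) (y m) (z m).
Proof.
move=> mN Nadj; elim: n m x y z => [|n IH] m x y z.
  rewrite mulr1; apply: le_pr; [|exact: measurable_hist3|by move=> w [[]]].
  by apply: measurableD => //; apply: measurableI; [apply: measurable_hist3|apply: measurable_obey].
set S := _ `\` N.
have mS : measurable S.
  by apply: measurableD => //; apply: measurableI; [apply: measurable_hist3|apply: measurable_obey].
have mW (W : nat -> T -> V) v : (forall n (B : set V), measurable (W n @^-1` B)) ->
    measurable [set w | W m.+1 w = v].
  by move=> mW; have := mW m.+1 [set v].
have Sadj w : S w ->
    [/\ X m.+1 w \in neighbours (x m), Y m.+1 w \in neighbours (y m) &
      Z m.+1 w \in neighbours (z m)].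
  move=> [[[[Hx Hy] Hz] _] Nw]; have [ax ay az] := Nadj _ Nw m.
  by rewrite -Hx// -Hy// -Hz//; split; apply: adj_neighbours; eassumption.
apply: le_trans (pr_split (s := neighbours (x m)) (k := m.+1) mX mS _) _; first by move=> w /Sadj[].
rewrite sieveS /transition3 {1}/transition mulr_sumr; apply: ler_sum => x' _.
set S1 := S `&` _; have mS1 : measurable S1 by apply: measurableI => //; exact: mW.
apply: le_trans (pr_split (s := neighbours (y m)) (k := m.+1) mY mS1 _) _;
  first by move=> w [/Sadj[]].
rewrite {1}/transition !mulr_sumr; apply: ler_sum => y' _.
set S2 := S1 `&` _; have mS2 : measurable S2 by apply: measurableI => //; exact: mW.
apply: le_trans (pr_split (s := neighbours (z m)) (k := m.+1) mZ mS2 _) _;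
  first by move=> w [[/Sadj[]]].
rewrite {1}/transition !mulr_sumr; apply: ler_sum => z' _.
set S3 := S2 `&` _; have mS3 : measurable S3 by apply: measurableI => //; exact: mW.
have [A'|nA] := boolP (A m.+1 x' y' z'); last first.
  rewrite mul0r !mulr0 (_ : S3 = set0) ?pr0//; apply/seteqP; split => // w.
  move=> [[[[[_ Aw] _] /= Xw] /= Yw] /= Zw]; move: nA; rewrite -Xw -Yw -Zw => /negP; apply.
  by apply: Aw; rewrite ltnS leqnn addnS ltnS leq_addr.
rewrite mul1r; have := IH m.+1 (extend x m x') (extend y m y') (extend z m z').
rewrite pr_hist3S !extend_id !extend_new hist3_extend_id.
move=> IH'; apply: le_trans (le_trans _ IH') _; last by rewrite !mulrA.
apply: le_pr => //.
  by apply: measurableD => //; apply: measurableI; [apply: measurable_hist3|apply: measurable_obey].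
move=> w [[[[[[[Hx Hy] Hz] Aw] Nw] /= Xw] /= Yw] /= Zw].
split=> //; split.
  by split; [split|]; rewrite [hist _ _ _](hist_extend).
move=> k /andP[mk kn]; apply: Aw; rewrite (ltnW mk) /=.
by rewrite addnS -addSn.
Qed.

Lemma pr_obey A n : pr (obey A 0 n) <= sieve R h A n 0 o o o.
Proof.
have [N [mN N0 NP]] := illegal_null.
pose S := (hist3 0 (fun=> o) (fun=> o) (fun=> o) `&` obey A 0 n) `\` N.
have mS : measurable S.
  by apply: measurableD => //; apply: measurableI; [apply: measurable_hist3|apply: measurable_obey].
apply: (@le_trans _ _ (pr S)).
  rewrite -[leRHS]addr0 -N0; apply: le_trans (prU mS mN).
  apply: le_pr; [exact: measurable_obey|exact: measurableU|].
  move=> w Aw; have [Nw|Nw] := pselect (N w); [by right|left; split=> //; split=> //].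
  have [X0 Y0 Z0 _] := NP w Nw.
  by split; [split|] => k; rewrite leqn0 => /eqP ->.
have Nadj w : ~ N w -> forall n,
   [/\ adj h (X n w) (X n.+1 w), adj h (Y n w) (Y n.+1 w) & adj h (Z n w) (Z n.+1 w)].
  by move=> /NP[].
apply: le_trans (pr_obey_hist A n 0 _ _ _ mN Nadj) _.
rewrite -[leRHS]mul1r ler_wpM2r ?sieve_ge0//.
by rewrite -lee_fin -prE ?probability_le1//; exact: measurable_hist3.
Qed.

Hypothesis h_mono : {homo h : m n / (m <= n)%N}.

Definition meeting n : set T := [set w | meet (X n w) (Y n w) (Z n w)].

Lemma measurable_meeting n : measurable (meeting n).
Proof. exact: measurable_meet3. Qed.

Lemma meeting_timesE w :
  [set n | X n w = Y n w /\ Y n w = Z n w] = [set n | meeting n w].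
Proof.
apply/seteqP; split => n; rewrite /meeting /meet /=.
  by move=> [-> ->]; rewrite eqxx.
by move=> /andP[/eqP -> /eqP ->].
Qed.

Lemma finite_nat_bounded (S : set nat) :
  finite_set S <-> exists N, forall n, (N < n)%N -> ~ S n.
Proof.
split => [/finite_fsetP[A ->]|[N SN]].
  exists (\max_(n <- finmap.enum_fset A) n)%N => n Nn /= nA; move: Nn; rewrite ltnNge.
  by rewrite (leq_bigmax_seq n).
apply: (sub_finite_set _ (finite_II N.+1)) => n Sn /=; rewrite ltnS leqNgt.
by apply/negP => /SN.
Qed.

Lemma pr_meeting n : pr (meeting n) <= collision R h n n o o o.
Proof.
case: n => [|n].
  by rewrite collision0 ?vertex_base// /meet !eqxx -lee_fin -prE ?probability_le1//;
    exact: measurable_meeting.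
have := pr_obey (fun k u v u' => (k == n.+1) ==> meet u v u') n.+1.
rewrite (sieve_meet R h_mono (L := n.+1) o o (add0n _)) ?vertex_base//.
apply: le_trans; apply: le_pr; [exact: measurable_meeting|exact: measurable_obey|].
by move=> w Mw k _; apply/implyP => /eqP ->.
Qed.

(** Borel-Cantelli, with the finite set of meeting times as complement of the
    limit superior of the meeting events. *)
Lemma almost_surely_finite b :
  (forall n, \sum_(0 <= k < n) collision R h k k o o o <= b) ->
  P [set w | finite_set [set n : nat | X n w = Y n w /\ Y n w = Z n w]] = 1%E.
Proof.
move=> cb; have L0 : P (lim_sup_set meeting) = 0%E.
  apply: lim_sup_set_cvg0 => //; first exact: measurable_meeting.
  apply: (@le_lt_trans _ _ b%:E); last exact: ltry.
  apply: lime_le; first by apply: is_cvg_nneseries => n _ _; apply: measure_ge0.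
  apply: nearW => n; rewrite (eq_bigr (fun k => (pr (meeting k))%:E)); last first.
    by move=> k _; apply/prE/measurable_meeting.
  rewrite sumEFin lee_fin; apply: le_trans (cb n).
  by apply: ler_sum => k _; apply: pr_meeting.
have mL : measurable (lim_sup_set meeting).
  apply: bigcapT_measurable => n; apply: bigcup_measurable => k _.
  exact: measurable_meeting.
rewrite (_ : [set w | _] = ~` lim_sup_set meeting).
  by rewrite probability_setC// L0 sube0.
apply/seteqP; split => w /=; rewrite meeting_timesE finite_nat_bounded.
  by move=> [N NM] /(_ N.+1 I)[n /= Nn Mn]; apply: NM Mn.
move=> /existsNP[N]; rewrite not_implyE => -[_ NM]; exists N => n Nn Mn.
by apply: NM; exists n => //=; exact: ltnW.
Qed.

(** For each [N] the event of no meeting after time [N] is null, being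
    contained for every [n] in the event of no meeting between [N] and [N + n]. *)
Lemma almost_surely_infinite :
  (forall e : R, 0 < e -> forall L, exists n, forall u v u',
     good h L u v u' -> miss R h n u v u' <= e) ->
  P [set w | infinite_set [set n : nat | X n w = Y n w /\ Y n w = Z n w]] = 1%E.
Proof.
move=> small; pose F N := \bigcap_(k in [set k | (N < k)%N]) ~` meeting k.
have mF N : measurable (F N).
  apply: bigcap_measurable => [|k _]; first by exists N.+1 => /=.
  by apply: measurableC; apply: measurable_meeting.
have F0 N : P (F N) = 0%E.
  rewrite prE//; congr (_%:E); apply/eqP; rewrite eq_le pr_ge0 andbT.
  apply/ler_addgt0Pl => e e0; rewrite addr0.
  have [n nP] := small e e0 N.
  have := pr_obey (fun k u v u' => (N < k)%N ==> ~~ meet u v u') (N + n).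
  have g0 : good h 0 o o o by split; rewrite ?vertex_base.
  move=> /le_trans /(_ (sieve_miss_le (L := 0%N) (ltW e0) (add0n N) nP g0)).
  apply: le_trans; apply: le_pr => //; first exact: measurable_obey.
  by move=> w Fw k _; apply/implyP => Nk; apply/negP; apply: Fw.
have mU : measurable (\bigcup_N F N) by apply: bigcupT_measurable.
have U0 : P (\bigcup_N F N) = 0%E.
  apply: measure_negligible => //; apply: negligible_bigcup => N.
  by apply/(@negligibleP _ _ _ P); [exact: mF|exact: F0].
rewrite (_ : [set w | _] = ~` \bigcup_N F N).
  by rewrite probability_setC// U0 sube0.
apply/seteqP; split => w /=; rewrite meeting_timesE finite_nat_bounded.
  by move=> inf [N _ FN]; apply: inf; exists N => n Nn; apply: FN.
by move=> nF [N NM]; apply: nF; exists N => // n Nn; apply: NM.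
Qed.

End Chains.

(** * The comb with teeth of height a power of the logarithm *)

Section Teeth.
Variables (R : realType) (alpha : R).
Hypothesis alpha_gt0 : 0 < alpha.

(** The largest height of a vertex on the tooth at distance [m]. *)
Definition tooth_height (m : nat) : nat := Num.truncn (comb_height alpha m%:Z).

Lemma comb_height_absz (n : int) : comb_height alpha n = comb_height alpha (`|n|%N)%:Z.
Proof. by rewrite /comb_height eqz_nat absz_eq0 -[in RHS]abszE absz_nat abszE. Qed.

Lemma comb_heightE m : (0 < m)%N -> comb_height alpha m%:Z = ln (m%:R : R) `^ alpha.
Proof.
move=> m0; rewrite /comb_height eqz_nat gtn_eqF//.
by rewrite -abszE absz_nat max_r ?powR_ge0.
Qed.

Lemma comb_height_ge0 n : 0 <= comb_height alpha n.
Proof. by rewrite /comb_height; case: ifP => // _; rewrite le_max lexx. Qed.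

Lemma tooth_height_mono : {homo tooth_height : m n / (m <= n)%N}.
Proof.
move=> [|m] n mn; first by rewrite /tooth_height /comb_height eqxx truncn0.
apply: le_truncn; rewrite !comb_heightE ?(leq_trans _ mn)//.
apply: ge0_ler_powR; rewrite ?nnegrE ?ln_ge0 ?ler1n ?(leq_trans _ mn)//; first exact: ltW.
by rewrite ler_ln ?posrE ?ltr0n ?ler_nat ?(leq_trans _ mn).
Qed.

Lemma comb_vertexE v : comb_vertex alpha v <-> vertex tooth_height v.
Proof.
case: v => a b; rewrite /comb_vertex /vertex /= comb_height_absz; split.
  move=> [b0 bh]; rewrite b0 /=; case: b b0 bh => // b _ bh.
  by rewrite lez_nat truncn_ge_nat// comb_height_ge0.
move=> /andP[b0 bh]; split=> //; case: b b0 bh => // b _.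
by rewrite lez_nat truncn_ge_nat// comb_height_ge0.
Qed.

Lemma comb_adjE u v : comb_adj alpha u v <-> adj tooth_height u v.
Proof.
rewrite /comb_adj /adj; split.
  move=> [/comb_vertexE -> /comb_vertexE -> e] /=.
  by case: e => -[[n [-> ->]]|[n [x [-> ->]]]]; rewrite /= ?eqxx ?orbT.
move=> /and3P[/comb_vertexE vu /comb_vertexE vv e]; split=> //.
case: u v e {vu vv} => [a b] [a' b'] /= /orP[/and3P[/eqP -> /eqP -> /orP[]/eqP ->]|].
- by left; left; exists a.
- by right; left; exists a'.
move=> /andP[/eqP -> /orP[]/eqP ->].
- by left; right; exists a', b.
- by right; right; exists a', b'.
Qed.

Lemma degreeE u : degree (comb_adj alpha) u = deg tooth_height u.
Proof.
have fin : finite_set [set v | comb_adj alpha u v].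
  by apply: (sub_finite_set _ (finite_seq (neighbours u))) => v /comb_adjE /adj_neighbours.
rewrite /degree /deg -size_filter; apply: perm_size; apply: uniq_perm.
- exact: finmap.fset_uniq.
- by rewrite filter_uniq ?uniq_neighbours.
- move=> v; rewrite in_fset_set// mem_filter; apply/idP/idP; rewrite inE /=.
    by move=> /comb_adjE uv; rewrite uv (adj_neighbours uv).
  by move=> /andP[/comb_adjE].
Qed.

Lemma srw_stepE u v : srw_step (comb_adj alpha) u v = step R tooth_height u v.
Proof.
rewrite /srw_step /step degreeE; case: (boolP (adj tooth_height u v)) => uv.
  by rewrite ifT ?mul1r//; apply/asboolP/comb_adjE.
by rewrite ifF ?mul0r//; apply/asboolP => /comb_adjE; rewrite (negbTE uv).
Qed.

Let L2 : R := ln 2.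
Let L2_gt0 : 0 < L2. Proof. by rewrite ln_gt0// ltr1n. Qed.

Lemma ln2_le1 : L2 <= 1.
Proof.
rewrite /L2 -ler_expR lnK ?posrE//; apply: le_trans (expR_ge1Dx 1).
by rewrite -[2]/(1 + 1).
Qed.

Lemma exp_ln2 : expR L2 = 2. Proof. by rewrite /L2 lnK// posrE. Qed.

Lemma tooth_height_pow2 j : tooth_height (2 ^ j) = Num.truncn ((j%:R * L2) `^ alpha).
Proof. by rewrite /tooth_height comb_heightE ?expn_gt0// natrX lnXn// mulr_natl. Qed.

Lemma dyadic_ge0 j : 0 <= j%:R * L2. Proof. by rewrite mulr_ge0// ltW. Qed.

Definition doubling : nat := (Num.truncn ((2 : R) `^ alpha)).+2.

Lemma tooth_size_doubling j :
  (tooth_size tooth_height j.+1 <= doubling * tooth_size tooth_height j)%N.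
Proof.
rewrite /tooth_size !tooth_height_pow2; set x := (j%:R * L2) `^ alpha.
have x0 : 0 <= x by apply: powR_ge0.
have D0 : 0 <= (2 : R) `^ alpha by apply: powR_ge0.
have [->|j0] := posnP j.
  rewrite mul1r; apply: (@leq_trans 2); last exact: leq_trans (leq_pmulr doubling _).
  rewrite ltnS -ltnS truncn_lt_nat ?powR_ge0//.
  apply: (@le_lt_trans _ _ 1); last by rewrite ltr1n.
  have e1 : 1 `^ alpha = 1 :> R by rewrite powR1.
  rewrite -[leRHS]e1; apply: ge0_ler_powR; rewrite ?nnegrE ?(ltW alpha_gt0)//.
    exact: ltW.
  exact: ln2_le1.
have up : (j.+1%:R * L2) `^ alpha <= 2 `^ alpha * x.
  rewrite -powRM// ?dyadic_ge0//; apply: ge0_ler_powR;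
    rewrite ?nnegrE ?(ltW alpha_gt0) ?dyadic_ge0//.
    by rewrite mulr_ge0// dyadic_ge0.
  by rewrite mulrA ler_pM2r// -natrM ler_nat mul2n -addnn -addn1 leq_add2l.
have xt : x < (Num.truncn x).+1%:R by apply: truncnS_gt.
have Dt : (2 : R) `^ alpha < (Num.truncn ((2 : R) `^ alpha)).+1%:R by apply: truncnS_gt.
rewrite truncn_lt_nat ?powR_ge0//; apply: le_lt_trans up _.
rewrite /doubling natrM; apply: ltr_pM => //.
by apply: lt_trans Dt _; rewrite ltr_nat.
Qed.

Lemma tooth_height_log j : alpha <= 1 -> (tooth_height (2 ^ j) <= j)%N.
Proof.
move=> a1; rewrite tooth_height_pow2; case: j => [|j].
  by rewrite mul0r powR0 ?gt_eqF// truncn0.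
rewrite -ltnS truncn_lt_nat ?powR_ge0//; apply: (@le_lt_trans _ _ j.+1%:R); last by rewrite ltr_nat.
apply: (@le_trans _ _ (j.+1%:R `^ alpha)).
  apply: ge0_ler_powR; rewrite ?nnegrE ?dyadic_ge0 ?(ltW alpha_gt0)//.
  by rewrite ler_piMr// ln2_le1.
by apply: ler1_powR => //; rewrite ler1n.
Qed.

(** [((3 j + 6) ln 2) ^ alpha] is at most [2 ^ j], because with
    [c = ln 2 / (2 alpha)] one has [2 ^ j = (expR (j c) ^ 2) ^ alpha], and
    [expR (j c) ^ 2] is at least [(1 + j c) ^ 2], which beats a linear function of
    [j]. *)
Lemma tooth_height_polylog : exists j0, forall j,
  (j0 <= j)%N -> (tooth_height (2 ^ (3 * j + 6)) <= 2 ^ j)%N.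
Proof.
pose c := L2 / (2 * alpha); have c0 : 0 < c by rewrite divr_gt0// mulr_gt0.
have [j0 j0P] : exists j0 : nat, 9 / c ^+ 2 <= j0.+1%:R.
  exists (Num.truncn (9 / c ^+ 2)); exact: ltW (truncnS_gt _).
exists j0.+1 => j jj; rewrite tooth_height_pow2 -ltnS truncn_lt_nat ?powR_ge0//.
apply: (@le_lt_trans _ _ (2 ^ j)%:R); last by rewrite ltr_nat.
have e2 : (expR (j%:R * c) ^+ 2) `^ alpha = (2 ^ j)%:R.
  have -> : (2 ^ j)%:R = expR (j%:R * L2) by rewrite natrX expRM_natl exp_ln2.
  rewrite -expRM_natr /powR expR_eq0 expRK; congr expR.
  by rewrite /c; field; rewrite gt_eqF.
rewrite -e2; apply: ge0_ler_powR; rewrite ?nnegrE ?dyadic_ge0 ?(ltW alpha_gt0)//.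
have j1 : 1 <= j%:R :> R by rewrite ler1n (leq_trans _ jj).
have jc : 9 <= c ^+ 2 * j%:R.
  rewrite mulrC -ler_pdivrMr ?exprn_gt0//; apply: le_trans j0P _.
  by rewrite ler_nat.
apply: (@le_trans _ _ ((3 * j + 6)%:R)); first by rewrite ler_piMr// ln2_le1.
have jc0 : 0 <= j%:R * c by rewrite mulr_ge0// ltW.
have e1 : (1 + j%:R * c) ^+ 2 <= expR (j%:R * c) ^+ 2.
  rewrite ler_pXn2r ?nnegrE ?expR_ge0 ?expR_ge1Dx//.
  by rewrite addr_ge0.
apply: le_trans e1; rewrite (natrD _ (3 * j)) natrM.
have := ler_wpM2r (ler0n R j) jc.
by move: (j%:R : R) j1 jc0 => y *; nra.
Qed.

(** Dyadic condensation, with a geometric series of ratio [2 ^ (1 - alpha)]. *)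
Lemma sum_inv_tooth_size_bounded : 1 < alpha ->
  exists b : R, forall J, \sum_(0 <= j < J) (tooth_size tooth_height j)%:R^-1 <= b.
Proof.
move=> a1; pose r : R := 2 / 2 `^ alpha; pose K := (L2 `^ alpha)^-1.
have K0 : 0 < K by rewrite invr_gt0 powR_gt0.
have D0 : 0 < (2 : R) `^ alpha by rewrite powR_gt0.
have r0 : 0 <= r by rewrite divr_ge0// ltW.
have r1 : r < 1.
  rewrite ltr_pdivrMr// mul1r -[ltLHS]powRr1//.
  by rewrite /powR pnatr_eq0 /= ltr_expR ltr_pM2r.
exists (1 + K / (1 - r)) => J.
have inv0 j : 0 <= (tooth_size tooth_height j)%:R^-1 :> R by rewrite invr_ge0.
have block i : \sum_(2 ^ i <= j < 2 ^ i.+1) (tooth_size tooth_height j)%:R^-1 <= K * r ^+ i.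
  apply: (@le_trans _ _ (\sum_(2 ^ i <= j < 2 ^ i.+1) (tooth_size tooth_height (2 ^ i))%:R^-1)).
    rewrite [leLHS]big_nat [leRHS]big_nat; apply: ler_sum => j /andP[ij _].
    by rewrite lef_pV2 ?posrE ?ltr0n// ler_nat tooth_size_mono//; exact: tooth_height_mono.
  rewrite sumr_const_nat expnS mul2n -addnn addnK -[_ *+ (2 ^ i)]mulr_natl.
  have p0 : 0 < ((2 ^ i)%:R * L2) `^ alpha by rewrite powR_gt0// mulr_gt0// ltr0n expn_gt0.
  apply: (@le_trans _ _ ((2 ^ i)%:R * (((2 ^ i)%:R * L2) `^ alpha)^-1)).
    rewrite ler_wpM2l// lef_pV2 ?posrE ?ltr0n//.
    by rewrite /tooth_size tooth_height_pow2 ltW// truncnS_gt.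
  have pe : (2 ^+ i : R) `^ alpha = (2 `^ alpha) ^+ i.
    rewrite -(powR_mulrn i (powR_ge0 2 alpha)) -(powR_mulrn i (ler0n R 2)) -!powRrM.
    by rewrite (mulrC alpha).
  rewrite powRM ?(ltW L2_gt0)// natrX pe /r expr_div_n /K.
  rewrite le_eqVlt; apply/orP; left; apply/eqP.
  have : L2 `^ alpha != 0 by rewrite gt_eqF// powR_gt0.
  have : (2 : R) `^ alpha ^+ i != 0 by rewrite expf_neq0// gt_eqF.
  by move: (_ `^ alpha ^+ i) (2 ^+ i) (L2 `^ alpha) => x y z x0 z0; field; rewrite x0 z0.
have geo n : \sum_(0 <= i < n) r ^+ i * (1 - r) = 1 - r ^+ n.
  elim: n => [|n IH]; first by rewrite big_geq// expr0 subrr.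
  by rewrite big_nat_recr//= IH exprSr; ring.
have dy n : \sum_(0 <= j < 2 ^ n) (tooth_size tooth_height j)%:R^-1 <=
    1 + \sum_(0 <= i < n) K * r ^+ i.
  elim: n => [|n IH].
    rewrite big_nat1 big_geq// addr0 invf_le1 ?ltr0n// ler1n//.
  rewrite (big_cat_nat (leq0n (2 ^ n)) (_ : 2 ^ n <= 2 ^ n.+1)%N) ?leq_exp2l//=.
  by rewrite [X in _ <= _ + X]big_nat_recr//= addrA lerD.
apply: (@le_trans _ _ (\sum_(0 <= j < 2 ^ J) (tooth_size tooth_height j)%:R^-1)).
  rewrite [leRHS](big_cat_nat (leq0n J) (ltnW (ltn_expl J (ltnSn 1)))) /= lerDl.
  exact: sumr_ge0.
apply: le_trans (dy J) _; rewrite lerD2l -mulr_sumr ler_pM2l//.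
have r1' : 0 < 1 - r by rewrite subr_gt0.
rewrite -[leRHS]mul1r ler_pdivlMr// mulr_suml geo gerBl exprn_ge0//.
Qed.
End Teeth.

Theorem theorem1p1 (R : realType) (d : measure_display) (T : measurableType d)
  (P : probability T R) (alpha : R) (X Y Z : nat -> T -> int * int)
  (alpha_gt0 : 0 < alpha)
  (hX : simple_random_walk P (comb_adj alpha) (0, 0) X)
  (hY : simple_random_walk P (comb_adj alpha) (0, 0) Y)
  (hZ : simple_random_walk P (comb_adj alpha) (0, 0) Z)
  (hXYZ : independent3 P X Y Z) :
  (1 < alpha ->
    P [set w | finite_set [set n : nat | X n w = Y n w /\ Y n w = Z n w]] = 1%E)
  /\
  (alpha <= 1 ->
    P [set w | infinite_set [set n : nat | X n w = Y n w /\ Y n w = Z n w]] = 1%E).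
Proof.
have mono := tooth_height_mono alpha_gt0; have dbl := tooth_size_doubling alpha_gt0.
split=> a1.
  have [j0 j0P] := tooth_height_polylog alpha_gt0.
  have [b bP] := sum_inv_tooth_size_bounded alpha_gt0 a1.
  have [b' b'P] := collision_summable mono dbl j0P bP.
  exact: (almost_surely_finite (srw_stepE alpha) hX hY hZ hXYZ mono b'P).
have [c [c0 c1 cP]] := @miss_uniform R _ mono _ dbl isT (fun j => tooth_height_log alpha_gt0 j a1).
apply: (almost_surely_infinite (srw_stepE alpha) hX hY hZ hXYZ) => e e0 L.
have [m me] : exists m, c ^+ m <= e.
  have cN : `|c| < 1 by rewrite ger0_norm.
  have /cvgrPdist_le/(_ e e0)[N _ HN] := cvg_geometric 1 cN.
  exists N; have := HN N (leqnn N); rewrite /= sub0r normrN mul1r ger0_norm//.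
  exact: exprn_ge0.
have [n nP] := miss_geometric c0 cP m L.
by exists n => x y z /nP /le_trans; apply.
Qed.
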